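(* Let $I=[0,1]$ or $I=[0,\infty)$. The space $Ces_\infty(I)$ is isomorphic to the space $(\bigoplus_{k=1}^\infty\mathcal M[0,1])_{l_\infty}$.
   Context: $Ces_\infty(I)$ is the space of measurable functions $f$ on $I$ with $\|f\|=\sup_{x\in I,x>0}\frac1x\int_0^x|f(t)|\,dt<\infty$. $\mathcal M[0,1]$ is the Banach space of regular Borel (signed) measures on $[0,1]$ of finite variation with the total variation norm. $(\bigoplus_{k}X_k)_{l_\infty}$ is the space of sequences $(x_k)$, $x_k\in X_k$, with $\sup_k\|x_k\|<\infty$, normed by this supremum. *)

(* Defs.v *)
From HB Require Import structures.
From mathcomp Require Import all_boot all_order all_algebra.
From mathcomp Require Import all_classical all_reals all_analysis.
Import Order.TTheory GRing.Theory Num.Theory numFieldNormedType.Exports.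
Local Open Scope classical_set_scope.
Local Open Scope ring_scope.

Definition ces_norm {R : realType} (I : set R) (f : R -> R) : \bar R :=
  ereal_sup [set ((x^-1)%:E * \int[lebesgue_measure]_(t in `[0%R, x]) (`|f t|)%:E)%E
            | x in I `&` `]0, +oo[].

(* Ces_inf(I): measurable functions on I with finite Cesaro norm
   (elements of the Banach space are their classes modulo a.e. equality). *)
Definition Ces_inf {R : realType} (I : set R) : set (R -> R) :=
  [set f | measurable_fun I f /\ (ces_norm I f < +oo)%E].

Definition tv01 {R : realType} (mu : set R -> \bar R) : \bar R :=
  ereal_sup [set s | exists (n : nat) (F : nat -> set R),
     (forall i, measurable (F i) /\ F i `<=` `[0, 1]) /\
     trivIset [set: nat] F /\
     s = (\sum_(i < n) `|mu (F i)|)%E].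

Definition linf_tv01 {R : realType} (nu : nat -> set R -> \bar R) : \bar R :=
  ereal_sup [set tv01 (nu k) | k in [set: nat]].

(* Main.v *)
Require Import Defs.
From HB Require Import structures.
From mathcomp Require Import all_boot all_order all_algebra.
From mathcomp Require Import all_classical all_reals all_analysis.
From mathcomp Require Import measurable_realfun zify ring lra.
Import Order.TTheory GRing.Theory Num.Theory numFieldNormedType.Exports.
Local Open Scope classical_set_scope.
Local Open Scope ring_scope.

Set Implicit Arguments.
Unset Strict Implicit.
Unset Printing Implicit Defensive.

(* Cutting I at the powers of 2 identifies Ces_inf(I) with the l_infty-sum X of
   copies of L_1[0,1], because the Cesaro norm is equivalent to the supremum of
   2^-z int_(]2^(z-1), 2^z]) |f|.  Let Y be the l_infty-sum of copies of M[0,1].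
   By the Pelczynski decomposition method, X and Y are isomorphic as soon as
   - L_1[0,1] is complemented in M[0,1]: Lebesgue decomposition;
   - M[0,1] is complemented in X: embed a measure as the sequence of its
     averages over finer and finer grids, and project a bounded sequence of
     densities onto its weak-* limit along a fixed ultrafilter. *)

(** * Spaces given by their closed balls *)

(** Mere retractions suffice because both sides are l_infty-sums: a retraction of X onto M[0,1]
    gives, coordinate by coordinate, one of the l_infty-sum of copies of X onto Y, and that sum is X
    again. The delicate map is the projection of X onto M[0,1]. It has to be linear, so a limit
    point extracted by compactness separately for each sequence will not do; a limit along one fixed
    ultrafilter is additive and exists for every bounded sequence of numbers. Weak-* convergence is
    expressed through distribution functions, so that only limits of real numbers occur. L_1[0,1] is
    realised inside M[0,1] as the absolutely continuous measures: equality almost everywhere becomes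
    equality of set functions, and Radon-Nikodym brings the densities back when surjectivity is
    proved. *)

(* [nball c x] reads "x belongs to the space and has norm at most c"; the
   carrier may contain vectors lying in no ball. *)
Record nspace (R : realType) := NSpace {
  car :> lmodType R ;
  nball : R -> car -> Prop ;
  nball_ge0 : forall c x, nball c x -> 0 <= c ;
  nball_le : forall c d x, c <= d -> nball c x -> nball d x ;
  nballD : forall c d x y, nball c x -> nball d y -> nball (c + d) (x + y) ;
  nballZ : forall c a x, nball c x -> nball (`|a| * c) (a *: x) }.
Arguments nball {R n}.

Section nspace_theory.
Context {R : realType}.
Implicit Types X Y Z : nspace R.

Definition ndom X : set X := [set x | exists c, nball c x].

Lemma nballB X c d (x y : X) : nball c x -> nball d y -> nball (c + d) (x - y).
Proof.
move=> cx dy; rewrite -scaleN1r; apply: nballD => //.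
by have := nballZ (-1) dy; rewrite normrN1 mul1r.
Qed.

(** Linearity is asked on [ndom] only: outside it lie vectors of infinite norm, such as unbounded
    sequences, where maps obtained by choice are uncontrolled. *)
Definition blinear X Y (T : X -> Y) :=
  (forall a x y, ndom x -> ndom y -> T (x + a *: y) = T x + a *: T y) /\
  (exists2 C, 0 < C & forall c x, nball c x -> nball (C * c) (T x)).

(** [Y] is isomorphic to a complemented subspace of [X]; the projection onto it is [j \o q]. *)
Definition retract Y X := exists (j : Y -> X) (q : X -> Y),
  [/\ blinear j, blinear q & forall y, ndom y -> q (j y) = y].

Definition niso X Y := exists (T : X -> Y) (S : Y -> X),
  [/\ blinear T, blinear S, (forall x, ndom x -> S (T x) = x)
    & forall y, ndom y -> T (S y) = y].

Lemma blinear_dom X Y (T : X -> Y) x : blinear T -> ndom x -> ndom (T x).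
Proof. by move=> [_ [C _ CT]] [c cx]; exists (C * c); exact: CT. Qed.

Lemma blinear_comp X Y Z (T : X -> Y) (S : Y -> Z) :
  blinear T -> blinear S -> blinear (S \o T).
Proof.
move=> bT bS; split=> [a x y dx dy /=|].
  by rewrite bT.1// bS.1//; apply: blinear_dom.
case: bT bS => _ [C C0 CT] [_ [D D0 DS]]; exists (D * C); first exact: mulr_gt0.
by move=> c x cx /=; rewrite -mulrA; exact/DS/CT.
Qed.

Lemma niso_sym X Y : niso X Y -> niso Y X.
Proof. by move=> [T [S [? ? ? ?]]]; exists S, T. Qed.

Lemma niso_trans X Y Z : niso X Y -> niso Y Z -> niso X Z.
Proof.
move=> [T [S [bT bS ST TS]]] [T' [S' [bT' bS' ST' TS']]].
exists (T' \o T), (S \o S'); split; try exact: blinear_comp.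
  by move=> x dx /=; rewrite ST' ?ST//; exact: blinear_dom.
by move=> x dx /=; rewrite TS ?TS'//; exact: blinear_dom.
Qed.

Lemma retract_niso X Y Z : retract X Y -> niso Y Z -> retract X Z.
Proof.
move=> [j [q [bj bq qj]]] [T [S [bT bS ST TS]]].
exists (T \o j), (q \o S); split; try exact: blinear_comp.
by move=> x dx /=; rewrite ST ?qj//; exact: blinear_dom.
Qed.

Section linf.
Variable X : nspace R.

Definition linf_ball c (x : nat -> X) := forall k, nball c (x k).

Lemma linf_ball_ge0 c x : linf_ball c x -> 0 <= c.
Proof. by move=> /(_ 0%N) /nball_ge0. Qed.

Lemma linf_ball_le c d x : c <= d -> linf_ball c x -> linf_ball d x.
Proof. by move=> cd cx k; exact: nball_le (cx k). Qed.

Lemma linf_ballD c d x y : linf_ball c x -> linf_ball d y -> linf_ball (c + d) (x + y).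
Proof. by move=> cx dy k; exact: nballD. Qed.

Lemma linf_ballZ c a x : linf_ball c x -> linf_ball (`|a| * c) (a *: x).
Proof. by move=> cx k; exact: nballZ. Qed.

Definition linf : nspace R :=
  NSpace linf_ball_ge0 linf_ball_le linf_ballD linf_ballZ.

Lemma linf_dom (x : linf) k : ndom x -> ndom (x k).
Proof. by move=> [c cx]; exists c; exact: cx. Qed.

End linf.

Section prod.
Variables X Y : nspace R.

Definition prod_ball c (x : X * Y) := nball c x.1 /\ nball c x.2.

Lemma prod_ball_ge0 c x : prod_ball c x -> 0 <= c.
Proof. by move=> [/nball_ge0]. Qed.

Lemma prod_ball_le c d x : c <= d -> prod_ball c x -> prod_ball d x.
Proof. by move=> cd [? ?]; split; exact: nball_le cd _. Qed.

Lemma prod_ballD c d x y : prod_ball c x -> prod_ball d y -> prod_ball (c + d) (x + y).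
Proof. by move=> [? ?] [? ?]; split; exact: nballD. Qed.

Lemma prod_ballZ c a x : prod_ball c x -> prod_ball (`|a| * c) (a *: x).
Proof. by move=> [? ?]; split; exact: nballZ. Qed.

Definition nprod : nspace R :=
  NSpace prod_ball_ge0 prod_ball_le prod_ballD prod_ballZ.

Lemma nprod_dom (x : nprod) : ndom x -> ndom x.1 /\ ndom x.2.
Proof. by move=> [c [? ?]]; split; exists c. Qed.

End prod.

Lemma niso_prodC X Y : niso (nprod X Y) (nprod Y X).
Proof.
by exists (fun z => (z.2, z.1)), (fun z => (z.2, z.1)); split => [||[]|[]]//;
  split=> //; exists 1 => // c [x y] [? ?]; rewrite mul1r.
Qed.

Lemma blinear_prod X Y Y' (T : Y -> Y') : blinear T ->
  blinear ((fun z => (z.1, T z.2)) : nprod X Y -> nprod X Y').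
Proof.
move=> [lT [C C0 CT]]; split=> [a x y /nprod_dom[_ dx] /nprod_dom[_ dy]|].
  by rewrite /= lT.
exists (1 + C); first by rewrite addr_gt0.
move=> c [x y] [cx cy]; have c0 := nball_ge0 cx; split => /=.
  by apply: nball_le cx; rewrite ler_peMl// lerDl ltW.
by apply: nball_le (CT _ _ cy); rewrite ler_wpM2r// lerDr.
Qed.

Lemma niso_prod2 X Y Y' : niso Y Y' -> niso (nprod X Y) (nprod X Y').
Proof.
move=> [T [S [bT bS ST TS]]].
exists (fun z => (z.1, T z.2)), (fun z => (z.1, S z.2)).
split; try exact: blinear_prod.
  by move=> [x y] /nprod_dom[_ dy] /=; rewrite ST.
by move=> [x y] /nprod_dom[_ dy] /=; rewrite TS.
Qed.

Lemma blinear_linf X Y (T : X -> Y) : blinear T ->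
  blinear ((fun x k => T (x k)) : linf X -> linf Y).
Proof.
move=> [lT [C C0 CT]]; split=> [a x y dx dy|].
  by apply/funext => k; rewrite /= lT//; exact: linf_dom.
by exists C => // c x cx k; exact: CT.
Qed.

Lemma retract_linf X Y : retract X Y -> retract (linf X) (linf Y).
Proof.
move=> [j [q [bj bq qj]]].
exists (fun x k => j (x k)), (fun x k => q (x k)).
split; try exact: blinear_linf.
by move=> x dx; apply/funext => k /=; rewrite qj//; exact: linf_dom.
Qed.

Lemma niso_linf2 X : niso (linf (linf X)) (linf X).
Proof.
have /card_esym/card_set_bijP[e [_ einj esurj]] := card_nat2.
have {}einj : injective e by move=> x y; apply: einj; rewrite inE.
have /choice[d de] : forall p, exists n, e n = p.
  by move=> p; have [n _ <-] := esurj p I; exists n.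
have ed n : d (e n) = n by apply: einj; rewrite de.
exists (fun x k => x (e k).1 (e k).2), (fun x k l => x (d (k, l))); split.
- by split=> //; exists 1 => // c x cx k; rewrite mul1r; exact: cx.
- by split=> //; exists 1 => // c x cx k l; rewrite mul1r; exact: cx.
- by move=> x _; apply/funext => k; apply/funext => l; rewrite de.
- by move=> x _; apply/funext => k; rewrite -surjective_pairing ed.
Qed.

(* Split each coordinate of [X] as [Y] plus the kernel of [q]; the isomorphism
   shifts the sequence of [Y]-components by one. *)
Lemma niso_linf_retract X Y : retract Y X -> niso (linf X) (nprod Y (linf X)).
Proof.
move=> [j [q [bj bq qj]]].
pose P x := j (q x).
have bP : blinear P by exact: (blinear_comp bq bj).
have dP x : ndom x -> ndom (P x) by exact: blinear_dom.
have PP x : ndom x -> P (P x) = P x.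
  by move=> dx; rewrite /P qj//; exact: blinear_dom.
have lB (Z Z' : nspace R) (T : Z -> Z') x y : blinear T -> ndom x -> ndom y ->
    T (x - y) = T x - T y.
  by move=> bT dx dy; rewrite -scaleN1r bT.1// scaleN1r.
have lD (Z Z' : nspace R) (T : Z -> Z') x y : blinear T -> ndom x -> ndom y ->
    T (x + y) = T x + T y.
  by move=> bT dx dy; rewrite -[y in LHS]scale1r bT.1// scale1r.
have dB (Z : nspace R) (x y : Z) : ndom x -> ndom y -> ndom (x - y).
  by move=> [c cx] [d dy]; exists (c + d); exact: nballB.
have qP x : ndom x -> q (P x) = q x.
  by move=> dx; rewrite /P qj//; exact: blinear_dom.
(* Each coordinate of [F] and [G] below has the shape x1 - x2 + x3, so this regrouping gives their
   linearity. *)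
have addrACN (V : lmodType R) (a : R) (x1 x2 x3 y1 y2 y3 : V) :
    (x1 + a *: y1) - (x2 + a *: y2) + (x3 + a *: y3) =
    x1 - x2 + x3 + a *: (y1 - y2 + y3).
  by rewrite scalerDr scalerBr opprD (addrACA x1) [LHS]addrACA.
pose F (x : linf X) : nprod Y (linf X) :=
  (q (x 0%N), fun n => x n - P (x n) + P (x n.+1)).
pose G (z : nprod Y (linf X)) : linf X := fun n =>
  z.2 n - P (z.2 n) + (if n is m.+1 then P (z.2 m) else j z.1).
exists F, G; split.
- split=> [a x y dx dy|].
    rewrite /F /=; congr (_, _); first by rewrite bq.1//; exact: linf_dom.
    apply/funext => n /=.
    by rewrite !bP.1 ?addrACN//; exact: linf_dom.
  case: bP bq => _ [C C0 CP] [_ [D D0 Dq]].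
  exists (D + (1 + C + C)); first by rewrite !addr_gt0.
  move=> c x cx; have c0 : 0 <= c by exact: nball_ge0 cx.
  split => [|k] /=.
    by apply: nball_le (Dq _ _ (cx 0%N)); rewrite ler_wpM2r// lerDl !addr_ge0// ltW.
  apply: (@nball_le _ _ (c + C * c + C * c)).
    by rewrite -{1}(mul1r c) -!mulrDl ler_wpM2r// lerDr ltW.
  by apply: nballD; [apply: nballB|]; try exact: CP; exact: cx.
- split=> [a x y /nprod_dom[dx1 dx2] /nprod_dom[dy1 dy2]|].
    apply/funext => -[|n]; rewrite /G /=.
      by rewrite bj.1// bP.1 ?addrACN//; exact: linf_dom.
    by rewrite !bP.1 ?addrACN//; exact: linf_dom.
  case: bP bj => _ [C C0 CP] [_ [D D0 Dj]].
  exists (D + (1 + C + C)); first by rewrite !addr_gt0.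
  move=> c [y x] [cy cx]; have c0 : 0 <= c by exact: nball_ge0 cx.
  move=> k; apply: (@nball_le _ _ (c + C * c + (D + C) * c)).
    rewrite -{1}(mul1r c) -!mulrDl ler_wpM2r//; lra.
  apply: nballD; first by apply: nballB; [exact: cx|exact/CP/cx].
  case: k => [|k] /=.
    by apply: nball_le (Dj _ _ cy); rewrite ler_wpM2r// lerDl ltW.
  by apply: nball_le (CP _ _ (cx k)); rewrite ler_wpM2r// lerDr ltW.
- move=> x dx; apply/funext => n; rewrite /G /F /=.
  have dxn k : ndom (x k) by exact: linf_dom.
  (* [P] kills the kernel component and fixes the shifted one, so the two components of a coordinate
     can be read off again. *)
  have E m : P (x m - P (x m) + P (x m.+1)) = P (x m.+1).
    rewrite lD//; [|exact: dB (dP _ _)|exact: dP].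
    by rewrite lB//; [|exact: dP]; rewrite !PP// subrr add0r.
  rewrite E addrK; case: n => [|n]; first by rewrite -/(P _) subrK.
  by rewrite E subrK.
- move=> [y x] /nprod_dom[/= dy dx]; rewrite /F /G /=.
  have dxn k : ndom (x k) by exact: linf_dom.
  have dj : ndom (j y) by exact: blinear_dom.
  have Pj : P (j y) = j y by rewrite /P qj.
  congr (_, _).
    rewrite lD//; last exact: dB (dP _ _).
    by rewrite lB//; [rewrite qP// subrr add0r qj|exact: dP].
  have E n : P (x n - P (x n) + match n with | 0%N => j y | m.+1 => P (x m) end) =
      match n with | 0%N => j y | m.+1 => P (x m) end.
    rewrite lD//; [|exact: dB (dP _ _)|by case: n => [|n]//; exact: dP].
    rewrite lB//; [|exact: dP]; rewrite PP// subrr add0r.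
    by case: n => [|n]//; rewrite PP.
  by apply/funext => n; rewrite !E addrK/= subrK.
Qed.

(** Each of the two sums absorbs the other: [linf X] ~ [linf Y] x [linf X] ~ [linf X] x [linf Y] ~
    [linf Y]. *)
Theorem pelczynski_decomposition X Y :
  retract X Y -> retract Y (linf X) -> niso (linf X) (linf Y).
Proof.
move=> XY YX.
(* Chain of isomorphisms: V ~ linf V ~ W x linf V ~ W x V. *)
have half (V W : nspace R) : niso (linf V) V -> retract W V ->
    niso V (nprod W V).
  move=> lV WV; apply: (niso_trans (niso_sym lV)).
  exact: niso_trans (niso_linf_retract WV) (niso_prod2 _ lV).
apply: (niso_trans (half _ (linf Y) (niso_linf2 X) _)).
  by apply: retract_niso (niso_linf2 X); exact: retract_linf.
apply: (niso_trans (niso_prodC _ _)); apply: niso_sym.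
by apply: half (niso_linf2 Y) _; exact: retract_linf.
Qed.

End nspace_theory.

(** * Real-valued signed measures on the Borel sets of R *)

Section rcharge.
Context {R : realType}.
Local Notation mR := (measurableTypeR R).
Implicit Types (m a b : set R -> R) (A B D : set R).

(* Signed measures are total functions that vanish on nonmeasurable sets, so
   that those agreeing on Borel sets are equal and form a vector space. *)
Definition onm m A : R := if `[< measurable A >] then m A else 0.

Lemma onmE m A : measurable A -> onm m A = m A.
Proof. by move=> mA; rewrite /onm asboolT. Qed.

Lemma onm_out m A : ~ measurable A -> onm m A = 0.
Proof. by move=> mA; rewrite /onm asboolF. Qed.

Definition rcharge m := [/\ m set0 = 0, (forall A, ~ measurable A -> m A = 0) &
  forall F : nat -> set R, (forall i, measurable (F i)) ->
    trivIset setT F ->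
    \sum_(0 <= i < n) m (F i) @[n --> \oo] --> m (\bigcup_i F i)].

Lemma rcharge_ext m m' : rcharge m -> rcharge m' ->
  (forall A, measurable A -> m A = m' A) -> m = m'.
Proof.
move=> [_ mo _] [_ mo' _] mm'; apply/funext => A.
have [mA|mA] := pselect (measurable A); first exact: mm'.
by rewrite mo// mo'.
Qed.

Lemma onm_id m : rcharge m -> onm m = m.
Proof.
move=> [_ mo _]; apply/funext => A.
by have [mA|mA] := pselect (measurable A); [rewrite onmE|rewrite onm_out ?mo].
Qed.

Lemma rcharge_fine (nu : set R -> \bar R) : nu set0 = 0%E ->
  (forall A, measurable A -> nu A \is a fin_num) ->
  @measure_function.semi_sigma_additive _ mR R nu -> rcharge (onm (fine \o nu)).
Proof.
move=> nu0 nufin nus; split.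
- by rewrite onmE//= nu0.
- by move=> A mA; rewrite onm_out.
- move=> F mF tF; have mU : measurable (\bigcup_i F i) by exact: bigcup_measurable.
  rewrite onmE//=; under eq_fun do under eq_bigr do rewrite onmE//=.
  have := nus F mF tF mU; rewrite -[X in _ --> X -> _](fineK (nufin _ mU)).
  move=> /fine_cvg; apply: cvg_trans; apply: near_eq_cvg.
  by apply: nearW => n /=; rewrite sum_fine// => i _; exact: nufin.
Qed.

Lemma rcharge_EFin m : rcharge m ->
  @measure_function.semi_sigma_additive _ mR R (EFin \o m).
Proof.
move=> [m0 mo ms] F mF tF mU.
rewrite (_ : (fun n => _) = (fun n => (\sum_(0 <= i < n) m (F i))%:E)); last first.
  by apply/funext => n; rewrite sumEFin.
by apply: cvg_EFin; [exact: nearW|exact: ms].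
Qed.

Lemma rcharge_charge m : rcharge m ->
  exists nu : {charge set mR -> \bar R}, forall A, nu A = (m A)%:E.
Proof.
move=> mc; have [m0 _ _] := mc.
have z : (EFin \o m) set0 = 0%E by rewrite /= m0.
pose nu : {charge set mR -> \bar R} := HB.pack (EFin \o m)
  (@isCharge.Build _ mR R (EFin \o m) z (fun _ _ => erefl) (rcharge_EFin mc)).
by exists nu.
Qed.

(** The charge lives over the default measurable structure of [R], the one in the final statement,
    instead of [mR]. *)
Lemma rcharge_charge_default m : rcharge m ->
  exists nu : {charge set R -> \bar R}, forall A, nu A = (m A)%:E.
Proof.
move=> mc; have [m0 _ _] := mc.
have z : (EFin \o m) set0 = 0%E by rewrite /= m0.
pose nu : {charge set R -> \bar R} := HB.pack (EFin \o m)
  (@isCharge.Build _ R R (EFin \o m) z (fun _ _ => erefl) (rcharge_EFin mc)).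
by exists nu.
Qed.

Lemma rcharge0 m : rcharge m -> m set0 = 0.
Proof. by case. Qed.

Lemma rchargeU m A B : rcharge m -> measurable A -> measurable B ->
  A `&` B = set0 -> m (A `|` B) = m A + m B.
Proof.
move=> /rcharge_charge[nu nuE] mA mB AB; apply: EFin_inj.
by rewrite EFinD -!nuE chargeU.
Qed.

Lemma rchargeDI m A B : rcharge m -> measurable A -> measurable B ->
  m A = m (A `\` B) + m (A `&` B).
Proof.
move=> cm mA mB; rewrite -rchargeU//; last 3 first.
- exact: measurableD.
- exact: measurableI.
- by rewrite setDE setIACA setICl setI0.
by rewrite setUC setUIDK.
Qed.

Lemma rcharge_linear m m' (r : R) : rcharge m -> rcharge m' ->
  rcharge (m + r *: m').
Proof.
move=> [m0 mo ms] [m0' mo' ms']; split.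
- by rewrite !fctE m0 m0' scaler0 addr0.
- by move=> A mA; rewrite !fctE mo// mo'// scaler0 addr0.
- move=> F mF tF.
  rewrite (_ : (fun n => _) = (fun n => \sum_(0 <= i < n) m (F i) +
      r * \sum_(0 <= i < n) m' (F i))); last first.
    by apply/funext => n; rewrite mulr_sumr -big_split.
  by apply: cvgD; [exact: ms|apply: cvgMr; exact: ms'].
Qed.

Lemma rcharge_zero : rcharge (0 : set R -> R).
Proof.
by split=> // F mF tF; under eq_fun do rewrite big1//; exact: cvg_cst.
Qed.

Lemma rchargeZ r m : rcharge m -> rcharge (r *: m).
Proof.
move=> cm; rewrite -[_ *: _]add0r.
exact: (rcharge_linear r rcharge_zero cm).
Qed.

Lemma rcharge_comp m (psi : R -> R) : rcharge m -> measurable_fun setT psi ->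
  rcharge (onm (fun A => m (psi @^-1` A))).
Proof.
move=> [m0 mo ms] mpsi; split.
- by rewrite onmE// preimage_set0.
- by move=> A mA; rewrite onm_out.
- move=> F mF tF; have mU : measurable (\bigcup_i F i) by exact: bigcup_measurable.
  rewrite onmE//=; under eq_fun do under eq_bigr do rewrite onmE//=.
  rewrite preimage_bigcup; apply: ms.
    by move=> i; rewrite -[X in measurable X]setTI; exact: mpsi.
  by move=> i j _ _ [x [xi xj]]; apply: tF => //; exists (psi x).
Qed.

Lemma rcharge_restr m D : rcharge m -> measurable D ->
  rcharge (onm (fun A => m (A `&` D))).
Proof.
move=> [m0 mo ms] mD; split.
- by rewrite onmE// set0I.
- by move=> A mA; rewrite onm_out.
- move=> F mF tF; have mU : measurable (\bigcup_i F i) by exact: bigcup_measurable.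
  rewrite onmE//=; under eq_fun do under eq_bigr do rewrite onmE//=.
  rewrite setI_bigcupl; apply: ms; first by move=> i; exact: measurableI.
  by move=> i j _ _ [x [[xi _] [xj _]]]; apply: tF => //; exists x.
Qed.

Definition rmeasure a := rcharge a /\ forall A, 0 <= a A.

Lemma rmeasure_measure a : rmeasure a ->
  exists mu : {measure set mR -> \bar R}, forall A, mu A = (a A)%:E.
Proof.
move=> [ac a0]; have z : (EFin \o a) set0 = 0%E by case: ac => /= ->.
pose mu : {measure set mR -> \bar R} := HB.pack (EFin \o a)
  (@isMeasure.Build _ mR R (EFin \o a) z a0 (rcharge_EFin ac)).
by exists mu.
Qed.

Lemma rmeasure_le a A B : rmeasure a -> measurable A -> measurable B ->
  A `<=` B -> a A <= a B.
Proof.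
move=> /rmeasure_measure[mu muE] mA mB AB; rewrite -lee_fin -!muE.
by apply: le_measure; rewrite ?inE.
Qed.

Lemma rmeasure_leT a A : rmeasure a -> a A <= a setT.
Proof.
move=> ma; have [mA|mA] := pselect (measurable A); first exact: rmeasure_le.
by case: (ma) => -[_ -> // _] ->.
Qed.

Lemma rmeasureD a b : rmeasure a -> rmeasure b -> rmeasure (a + b).
Proof.
move=> [ca a0] [cb b0]; split; last by move=> A; exact: addr_ge0.
by rewrite -[b]scale1r; exact: rcharge_linear.
Qed.

(** Differences of half-lines give the intervals ]s, t], which are stable under intersection and
    generate the Borel sets; the sets ]-n, n] exhaust the line with finite mass. *)
Lemma rmeasure_unique a b : rmeasure a -> rmeasure b ->
  (forall t, a `]-oo, t]%classic = b `]-oo, t]%classic) -> a = b.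
Proof.
move=> ra rb ab; apply: rcharge_ext; [exact: ra.1|exact: rb.1|].
have [ma maE] := rmeasure_measure ra; have [mb mbE] := rmeasure_measure rb.
move=> A mA; apply: EFin_inj; rewrite -maE -mbE.
apply: (@measure_unique _ R mR (@ocitv R)
  (fun n => `]- n%:R, n%:R]%classic : set R)) => //.
- exact: ocitvI.
- by move=> i; exact: is_ocitv.
- exact: (@bigcup_itvT R false false).
- move=> _ [[s t] _ <-] /=; rewrite maE mbE; congr EFin.
  have [st|ts] := leP s t; last first.
    by rewrite set_itv_ge ?(rcharge0 ra.1) ?(rcharge0 rb.1)// bnd_simp -leNgt ltW.
  have E : `]-oo, t]%classic `\` `]-oo, s]%classic = `]s, t]%classic :> set R.
    apply/seteqP; split=> x /=; rewrite !in_itv/=.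
      by move=> [-> /negP]; rewrite -ltNge => ->.
    by move=> /andP[sx ->]; split=> //; apply/negP; rewrite -ltNge.
  have E' : `]-oo, t]%classic `&` `]-oo, s]%classic = `]-oo, s]%classic :> set R.
    apply/seteqP; split=> x /=; rewrite !in_itv/=; first by case.
    by move=> xs; split=> //; exact: le_trans st.
  have := rchargeDI ra.1 (measurable_itv `]-oo, t]) (measurable_itv `]-oo, s]).
  have := rchargeDI rb.1 (measurable_itv `]-oo, t]) (measurable_itv `]-oo, s]).
  by rewrite E E' -!ab => -> /addIr.
- by move=> n; rewrite maE ltry.
Qed.

End rcharge.

(** * Measures on [0,1]: variation balls and Jordan decomposition *)

Section mball.
Context {R : realType}.
Implicit Types (m a b : set R -> R) (A B P N : set R).

(** A measure on [0,1] is encoded as a measure on the whole line that does not charge the complement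
    of [0,1]. *)
Definition on01 m := forall A, measurable A -> m (A `&` `[0, 1]%classic) = m A.

(* Total variation at most c, expressed on Hahn pairs (P, N). *)
Definition mball c m := [/\ rcharge m, on01 m & forall P N,
  measurable P -> measurable N -> P `&` N = set0 -> m P - m N <= c].

(** The parts are the restrictions to the two Hahn sets; the bound in [mball], applied to this very
    pair, controls the sum of their masses. *)
Lemma mball_jordan c m : mball c m -> exists a b,
  [/\ [/\ rmeasure a, rmeasure b, on01 a & on01 b], m = a - b &
      a setT + b setT <= c].
Proof.
move=> [cm m01 mc]; have [nu nuE] := rcharge_charge cm.
have [P [N [[mP Ppos] [mN Nneg] PNT PN0]]] := Hahn_decomposition nu.
have rP := rcharge_restr cm mP; have rN := rcharge_restr cm mN.
exists (onm (fun A => m (A `&` P))), (onm (fun A => - m (A `&` N))).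
have NE : onm (fun A => - m (A `&` N)) = (-1) *: onm (fun A => m (A `&` N)).
  apply/funext => A; rewrite !fctE /onm.
  by case: ifPn => _; rewrite ?scaler0 ?scaleN1r.
have rN' : rcharge (onm (fun A => - m (A `&` N))).
  by rewrite NE; exact: rchargeZ.
split; first split.
- split=> // A; rewrite /onm; case: ifPn => // /asboolP mA.
  by rewrite -lee_fin -nuE; apply: Ppos; [exact: measurableI|exact: subIsetr].
- split=> // A; rewrite /onm; case: ifPn => // /asboolP mA.
  rewrite oppr_ge0 -lee_fin -nuE; apply: Nneg; [exact: measurableI|exact: subIsetr].
- move=> A mA; rewrite !onmE//; last exact: measurableI.
  by rewrite setIAC m01//; exact: measurableI.
- move=> A mA; rewrite !onmE//; last exact: measurableI.
  by rewrite setIAC m01//; exact: measurableI.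
- apply: rcharge_ext => //; first by rewrite -scaleN1r; exact: rcharge_linear.
  move=> A mA; rewrite !fctE !onmE// opprK -rchargeU//; try exact: measurableI.
    by rewrite -setIUr PNT setIT.
  by rewrite setIACA PN0 setI0.
- by rewrite !onmE// !setTI; exact: mc.
Qed.

Lemma mball_of_jordan c a b : rmeasure a -> rmeasure b -> on01 a -> on01 b ->
  a setT + b setT <= c -> mball c (a - b).
Proof.
move=> ra rb a01 b01 abc; split.
- by rewrite -scaleN1r; apply: rcharge_linear; [exact: ra.1|exact: rb.1].
- by move=> A mA; rewrite !fctE a01// b01.
- move=> P N mP mN PN; rewrite !fctE.
  have := rmeasure_leT P ra; have := rmeasure_leT N rb.
  have := ra.2 N; have := rb.2 P; lra.
Qed.

Lemma rmeasure_mball d a : rmeasure a -> on01 a -> a setT <= d -> mball d a.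
Proof.
move=> ra a01 ad; split=> // [|P N mP mN PN]; first exact: ra.1.
by have := rmeasure_leT P ra; have := ra.2 N; lra.
Qed.

Lemma mball_ge0 c m : mball c m -> 0 <= c.
Proof.
by move=> [_ _ /(_ set0 set0)]; rewrite set0I subrr; exact.
Qed.

Lemma mball_le c d m : c <= d -> mball c m -> mball d m.
Proof.
move=> cd [? ? mc]; split=> // P N mP mN PN; exact: le_trans (mc _ _ _ _ _) cd.
Qed.

Lemma mballD c d m m' : mball c m -> mball d m' -> mball (c + d) (m + m').
Proof.
move=> [cm m01 mc] [cm' m01' mc']; split.
- by rewrite -[m']scale1r; exact: rcharge_linear.
- by move=> A mA; rewrite !fctE m01// m01'.
- move=> P N mP mN PN; rewrite !fctE.
  by have := mc P N mP mN PN; have := mc' P N mP mN PN; lra.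
Qed.

Lemma mballZ c r m : mball c m -> mball (`|r| * c) (r *: m).
Proof.
move=> [cm m01 mc]; split.
- exact: rchargeZ.
- by move=> A mA; rewrite !fctE m01.
- move=> P N mP mN PN; rewrite !fctE -scalerBr -[_ *: _]/(_ * _).
  have [r0|r0] := leP 0 r; first by rewrite ger0_norm// ler_wpM2l// mc.
  rewrite ltr0_norm// -mulrNN opprB ler_wpM2l ?oppr_ge0 ?(ltW r0)//.
  by apply: mc => //; rewrite setIC.
Qed.

Lemma mball_norm c m A : mball c m -> measurable A -> `|m A| <= c.
Proof.
move=> [cm _ mc] mA; rewrite ler_norml.
have := mc A set0 mA measurable0 (setI0 _).
have := mc set0 A measurable0 mA (set0I _).
by rewrite (rcharge0 cm); lra.
Qed.

Definition M01 : nspace R := NSpace mball_ge0 mball_le mballD mballZ.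

Definition abscont m :=
  forall A, measurable A -> @lebesgue_measure R A = 0%E -> m A = 0.

Definition acball c m := mball c m /\ abscont m.

Lemma acball_ge0 c m : acball c m -> 0 <= c.
Proof. by move=> [/mball_ge0]. Qed.

Lemma acball_le c d m : c <= d -> acball c m -> acball d m.
Proof. by move=> cd [? ?]; split=> //; exact: mball_le cd _. Qed.

Lemma acballD c d m m' : acball c m -> acball d m' -> acball (c + d) (m + m').
Proof.
move=> [? am] [? am']; split; first exact: mballD.
by move=> A mA A0; rewrite !fctE am// am'// addr0.
Qed.

Lemma acballZ c r m : acball c m -> acball (`|r| * c) (r *: m).
Proof.
move=> [? am]; split; first exact: mballZ.
by move=> A mA A0; rewrite !fctE am// scaler0.
Qed.

(* L_1[0,1], each density being identified with the measure it defines. *)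
Definition AC01 : nspace R := NSpace acball_ge0 acball_le acballD acballZ.

(** With Jordan parts a, b and a', b', equality of the distribution functions passes to the positive
    measures a + b' and a' + b, which half-lines determine. *)
Lemma mball_unique c d m m' : mball c m -> mball d m' ->
  (forall t, m `]-oo, t]%classic = m' `]-oo, t]%classic) -> m = m'.
Proof.
move=> /mball_jordan[a [b [[ra rb _ _] -> _]]].
move=> /mball_jordan[a' [b' [[ra' rb' _ _] -> _]]] ab.
suff : a + b' = a' + b.
  by move=> abE; apply/eqP; rewrite subr_eq addrAC -abE addrK.
apply: rmeasure_unique; try exact: rmeasureD.
by move=> t; have := ab t; rewrite !fctE; lra.
Qed.

End mball.

(** * The absolutely continuous part *)

Section lebesgue_part.
Context {R : realType}.
Local Notation mu := (@lebesgue_measure R).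
Implicit Types (m a b : set R -> R) (A B N : set R).

(* N is a null set carrying as much of [a] as possible. *)
Lemma lebesgue_singular_set a : rmeasure a -> exists N,
  [/\ measurable N, mu N = 0%E &
      forall A, measurable A -> mu A = 0%E -> a (A `\` N) = 0].
Proof.
move=> ra; pose S := [set a N | N in [set N | measurable N /\ mu N = 0%E]].
have hS : has_sup S.
  split; first by exists (a set0), set0 => //; split=> //; exact: measure0.
  by exists (a setT) => _ [N _ <-]; exact: rmeasure_leT.
(* Null sets that nearly attain the supremum; their countable union is still null and attains it. *)
have /choice[F FP] : forall k, exists N,
    [/\ measurable N, mu N = 0%E & sup S - k.+1%:R^-1 < a N].
  move=> k; have k0 : 0 < k.+1%:R^-1 :> R by rewrite invr_gt0.
  by have [_ [N [mN N0] <-] Nk] := sup_adherent k0 hS; exists N.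
have mF k : measurable (F k) by case: (FP k).
have mU : measurable (\bigcup_k F k) by exact: bigcup_measurable.
have U0 : mu (\bigcup_k F k) = 0%E.
  apply/negligibleP => //; apply: negligible_bigcup => k.
  by apply/negligibleP => //; case: (FP k).
have supU : sup S <= a (\bigcup_k F k).
  apply/ler_addgt0Pr => e e0.
  have [k ke] : exists k, k.+1%:R^-1 < e.
    exists (Num.bound e^-1); rewrite invf_plt ?posrE//.
    by apply: (lt_trans (archi_boundP _)); rewrite ?invr_ge0 ?ltW// ltr_nat.
  rewrite -lerBlDr; apply: le_trans (_ : sup S - k.+1%:R^-1 <= _).
    by rewrite lerB// ltW.
  case: (FP k) => _ _ /ltW /le_trans; apply.
  by apply: rmeasure_le => //; exact: bigcup_sup.
exists (\bigcup_k F k); split=> // A mA A0.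
apply/eqP; rewrite eq_le ra.2 andbT.
have mAD : measurable (A `\` \bigcup_k F k) by exact: measurableD.
(* Enlarging the maximiser by a null set cannot raise its mass above the supremum, so the added
   piece has mass 0. *)
have : a ((A `\` \bigcup_k F k) `|` \bigcup_k F k) <= sup S.
  apply: sup_upper_bound => //; exists ((A `\` \bigcup_k F k) `|` \bigcup_k F k) => //.
  split; first exact: measurableU.
  rewrite measureU0//; apply: subset_measure0 A0 => //; exact: subDsetl.
rewrite (rchargeU ra.1)//; last by rewrite setDE -setIA setICl setI0.
lra.
Qed.

(** A relation instead of a function, since the null set is not canonical; uniqueness of [m'] then
    makes the projection linear. *)
Definition acpart m m' := abscont m' /\ exists N,
  [/\ measurable N, mu N = 0%E & m' = onm (fun A => m (A `\` N))].

Lemma acpart_rcharge m m' : rcharge m -> acpart m m' -> rcharge m'.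
Proof.
move=> cm [_ [N [mN _ ->]]].
rewrite (_ : onm _ = onm (fun A => m (A `&` ~` N))); last first.
  by apply/funext => A; rewrite /onm setDE.
by apply: rcharge_restr => //; exact: measurableC.
Qed.

Lemma acpartD m m' A N : rcharge m -> acpart m m' -> measurable A ->
  measurable N -> mu N = 0%E -> m' (A `\` N) = m' A.
Proof.
move=> cm cm' mA mN N0; have rm' := acpart_rcharge cm cm'.
rewrite [RHS](rchargeDI rm' mA mN) (cm'.1 (A `&` N)) ?addr0//.
  exact: measurableI.
by apply: subset_measure0 N0 => //; exact: measurableI.
Qed.

(** Neither part notices the removal of a further null set, and off the union of both null sets each
    equals [m]. *)
Lemma acpart_unique m m1 m2 : rcharge m -> acpart m m1 -> acpart m m2 -> m1 = m2.
Proof.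
move=> cm a1 a2.
apply: rcharge_ext; [exact: acpart_rcharge a1|exact: acpart_rcharge a2|].
move=> A mA; case: (a1) => _ [N1 [mN1 N10 E1]]; case: (a2) => _ [N2 [mN2 N20 E2]].
rewrite -(acpartD cm a1 mA mN2 N20) -(acpartD cm a2 mA mN1 N10) E1 E2 !onmE//.
- by rewrite !setDDl setUC.
- exact: measurableD.
- exact: measurableD.
Qed.

Lemma acpart_linear r m1 m2 m1' m2' : rcharge m1 -> rcharge m2 ->
  acpart m1 m1' -> acpart m2 m2' -> acpart (m1 + r *: m2) (m1' + r *: m2').
Proof.
move=> c1 c2 a1 a2; have r1 := acpart_rcharge c1 a1; have r2 := acpart_rcharge c2 a2.
split; first by move=> A mA A0; rewrite !fctE (a1.1 A)// (a2.1 A)// scaler0 addr0.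
case: (a1) => _ [N1 [mN1 N10 E1]]; case: (a2) => _ [N2 [mN2 N20 E2]].
have mU : measurable (N1 `|` N2) by exact: measurableU.
exists (N1 `|` N2); split=> //; first by rewrite measureU0.
have rm := rcharge_restr (rcharge_linear r c1 c2) (measurableC mU).
rewrite (_ : onm _ = onm (fun A => (m1 + r *: m2) (A `&` ~` (N1 `|` N2))));
  last by apply/funext => A; rewrite /onm setDE.
apply: rcharge_ext => //; first exact: rcharge_linear.
move=> A mA; rewrite onmE// -setDE !fctE.
rewrite -(acpartD c1 a1 mA mN2 N20) -(acpartD c2 a2 mA mN1 N10) E1 E2 !onmE//.
- by rewrite !setDDl [N2 `|` N1]setUC.
- exact: measurableD.
- exact: measurableD.
Qed.

(** The null set is chosen for the sum of the Jordan parts: where this positive measure vanishes,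
    both parts vanish, hence so does [m]. *)
Lemma acpart_ex c m : mball c m -> exists2 m', acpart m m' & acball c m'.
Proof.
move=> mc; have [a [b [[ra rb _ _] mE abc]]] := mball_jordan mc.
have [N [mN N0 NP]] := lebesgue_singular_set (rmeasureD ra rb).
have abs : abscont (onm (fun A => m (A `\` N))).
  move=> A mA A0; rewrite onmE// mE !fctE.
  have := NP A mA A0; rewrite !fctE.
  by have := ra.2 (A `\` N); have := rb.2 (A `\` N); lra.
have ap : acpart m (onm (fun A => m (A `\` N))) by split=> //; exists N.
case: (mc) => cm m01 mPN.
exists (onm (fun A => m (A `\` N))) => //; split=> //; split.
- exact: acpart_rcharge ap.
- move=> A mA; rewrite !onmE//; last exact: measurableI.
  by rewrite setDE setIAC -setDE m01//; exact: measurableD.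
- move=> P Q mP mQ PQ; rewrite !onmE//; apply: mPN; try exact: measurableD.
  by rewrite !setDE setIACA PQ set0I.
Qed.

Lemma retract_AC_M : retract (@AC01 R) (@M01 R).
Proof.
(* The value must serve all radii [c] at once; uniqueness reconciles the parts obtained for
   different radii, and 0 is used on vectors lying in no ball. *)
have /choice[p pP] : forall m, exists m' : set R -> R,
    forall c, mball c m -> acpart m m' /\ acball c m'.
  move=> m; have [[c0 mc0]|nm] := pselect (exists c, mball c m); last first.
    by exists 0 => c mc; exfalso; apply: nm; exists c.
  have [m' am' _] := acpart_ex mc0; exists m' => c mc; split=> //.
  have [m'' am'' b''] := acpart_ex mc; rewrite (_ : m' = m'')//.
  by apply: (@acpart_unique m) => //; case: mc.
exists (id : @AC01 R -> @M01 R), (p : @M01 R -> @AC01 R); split.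
- by split=> //; exists 1 => // c x [? _]; rewrite mul1r.
- split.
    move=> r x y [c cx] [d dy]; have [ax _] := pP _ _ cx; have [ay _] := pP _ _ dy.
    have [az _] := pP _ _ (mballD cx (mballZ r dy)).
    case: cx dy => [rx _ _] [ry _ _].
    apply: (acpart_unique _ az); first exact: rcharge_linear.
    exact: acpart_linear.
  by exists 1 => // c x cx; rewrite mul1r; exact: (pP _ _ cx).2.
- move=> x [c [cx ax]]; have [px _] := pP _ _ cx; case: (cx) => rx _ _.
  apply: (acpart_unique rx px); split=> //; exists set0; split=> //.
  by rewrite -[LHS](onm_id rx); apply/funext => A; rewrite /onm setD0.
Qed.

End lebesgue_part.

(** * Weak limits of bounded sequences of measures *)

Section stieltjes.
Context {R : realType}.
Local Notation mR := (measurableTypeR R).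
Implicit Types (a : set R -> R).

(** The measure is the Lebesgue-Stieltjes measure of [F] cut down to ]-1, 1]. Starting at a negative
    point keeps the jump of [F] at 0 as an atom, while ]-1, 0[ gets no mass because [F] vanishes
    there. *)
Lemma stieltjes_rmeasure (F : R -> R) : {homo F : x y / x <= y} ->
  (forall t, F y @[y --> t^'+] --> F t) ->
  (forall t, t < 0 -> F t = 0) -> (forall t, 1 <= t -> F t = F 1) ->
  exists a, [/\ rmeasure a, on01 a, (forall t, a `]-oo, t]%classic = F t) &
    a setT = F 1].
Proof.
move=> nd rc F0 F1.
pose Fc : cumulative R R := HB.pack F (isCumulative.Build R _ R F nd rc).
pose L : {measure set mR -> \bar R} := lebesgue_stieltjes_measure Fc.
have LE s t : s <= t -> L `]s, t]%classic = (F t - F s)%:E.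
  move=> st; rewrite /L /= /lebesgue_stieltjes_measure /measure_extension.
  rewrite measurable_mu_extE/=; last exact: is_ocitv.
  by rewrite wlength_itv_bnd.
have mD : measurable (`]-1, 1]%classic : set mR) by exact: measurable_itv.
have LD : L `]-1, 1]%classic = (F 1)%:E by rewrite LE ?(F0 (-1)) ?subr0//; lra.
pose nu : {measure set mR -> \bar R} := mrestr L mD.
have nuE A : nu A = L (A `&` `]-1, 1]%classic) by [].
have nufin A : measurable A -> nu A \is a fin_num.
  move=> mA; rewrite ge0_fin_numE// nuE.
  apply: (@le_lt_trans _ _ (L `]-1, 1]%classic)); last by rewrite LD ltry.
  by apply: le_measure; rewrite ?inE//; exact: measurableI.
have L0 : L `]-1, 0[%classic = 0%E.
  rewrite itv_bnd_open_bigcup; apply/negligibleP.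
    by apply: bigcup_measurable => n _; exact: measurable_itv.
  apply: negligible_bigcup => n; apply/negligibleP; first exact: measurable_itv.
  have n0 : 0 < n.+1%:R^-1 :> R by rewrite invr_gt0.
  have n1 : n.+1%:R^-1 <= 1 :> R by rewrite invf_le1// ler1n.
  move: (n.+1%:R^-1) n0 n1 => e n0 n1.
  have E1 : F (0 - e) = 0 by apply: F0; lra.
  have E2 : F (-1) = 0 by apply: F0; lra.
  have E3 : -1 <= 0 - e by lra.
  by have := LE _ _ E3; rewrite E1 E2 subrr.
exists (onm (fine \o nu)); split.
- split; last first.
    by move=> A; rewrite /onm; case: ifPn => // /asboolP mA /=; exact: fine_ge0.
  apply: rcharge_fine => //. 
  exact: (@measure_semi_sigma_additive _ _ _ nu).
- move=> A mA; rewrite !onmE//; last exact: measurableI.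
  congr fine; rewrite !nuE.
  have mA1 : measurable (A `&` `[0, 1]%classic `&` `]-1, 1]%classic : set mR).
    by apply: measurableI => //; exact: measurableI.
  have mA2 : measurable (A `&` `]-1, 0[%classic : set mR) by exact: measurableI.
  rewrite -(measureU0 mA1 mA2).
    congr (L _); apply/seteqP; split=> x /=; rewrite !in_itv/=.
      by move=> [[[? _] ?]|[? /andP[? ?]]]//; split=> //; apply/andP; split=> //; lra.
    move=> [Ax /andP[? x1]]; have [x0|x0] := ltP x 0; [right|left].
      by split=> //; apply/andP.
    by split; [split=> //; apply/andP|apply/andP].
  by apply: subset_measure0 L0 => //; exact: subIsetr.
- move=> t; rewrite onmE//= nuE.
  have [t0|t0] := leP t (-1).
    rewrite (_ : _ `&` _ = set0) ?measure0/= ?F0//; first lra.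
    apply/seteqP; split=> x //=; rewrite !in_itv/= => -[xt /andP[x1 _]].
    by have := lt_le_trans x1 xt; rewrite ltNge t0.
  have [t1|t1] := leP t 1.
    have -> : `]-oo, t]%classic `&` `]-1, 1]%classic = `]-1, t]%classic :> set R.
      apply/seteqP; split=> x /=; rewrite !in_itv/=; first by move=> [-> /andP[-> _]].
      by move=> /andP[-> xt]; split=> //=; exact: le_trans t1.
    by rewrite LE/= ?(F0 (-1)) ?subr0//; lra.
  rewrite (_ : _ `&` _ = `]-1, 1]%classic) ?LD/= ?(F1 t)//; first exact: ltW.
  apply/seteqP; split=> x /=; rewrite !in_itv/=; first by move=> [].
  by move=> /andP[-> x1]; split=> //; rewrite (le_trans x1)// ltW.
- by rewrite onmE//= nuE setTI LD.
Qed.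

(** Monotonicity provides some right limit; continuity from above along t + 1/(n+1) identifies
    it. *)
Lemma rmeasure_right_continuous a t : rmeasure a ->
  a `]-oo, y]%classic @[y --> t^'+] --> a `]-oo, t]%classic.
Proof.
move=> ra; have [nu nuE] := rmeasure_measure ra.
pose G y := a `]-oo, y]%classic.
have nd x y : x <= y -> G x <= G y.
  move=> xy; apply: rmeasure_le => // z /=; rewrite !in_itv/= => /le_trans; exact.
have lG : has_lbound (G @` [set` Interval (BRight t) (BInfty _ false)]).
  by exists 0 => _ [z _ <-]; exact: ra.2.
have cG := @nondecreasing_at_right_cvgr R G t +oo%O isT (in2W nd) lG.
suff -> : a `]-oo, t]%classic = inf (G @` [set` Interval (BRight t) (BInfty _ false)]).
  exact: cG.
pose u n : R := t + n.+1%:R^-1.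
have cu : u n @[n --> \oo] --> t.
  rewrite -[X in _ --> X]addr0; apply: cvgD; [exact: cvg_cst|exact: cvg_harmonic].
have tu n : t < u n by rewrite ltrDl.
have := (cvg_at_rightP _ _ _).1 cG u (conj tu cu).
pose H n : set (measurableTypeR R) := `]-oo, u n]%classic.
have HI : \bigcap_n H n = `]-oo, t]%classic.
  apply/seteqP; split=> x /=; last first.
    by rewrite in_itv/= => xt n _; rewrite /H/= in_itv/= (le_trans xt)// ltW.
  move=> Hx; rewrite in_itv/=; apply: (cvgr_to_ge cu).
  by apply: nearW => n; have := Hx n I; rewrite /H/= in_itv.
have : (nu \o H) n @[n --> \oo] --> nu (\bigcap_n H n).
  apply: nonincreasing_cvg_mu.
  - by rewrite nuE ltry.
  - by move=> n; exact: measurable_itv.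
  - by rewrite HI; exact: measurable_itv.
  - move=> n m nm; apply/subsetPset => x; rewrite /H/= !in_itv/= => /le_trans; apply.
    by rewrite lerD2l lef_pV2 ?posrE// ler_nat.
rewrite HI nuE => /fine_cvg /=.
under [in X in X -> _]eq_fun do rewrite nuE/=.
by move=> h1 h2; exact: (cvg_unique _ h1 h2).
Qed.

End stieltjes.

Section ultralimit.
Context {R : realType} (U : set_system nat) {UU : UltraFilter U}.

(** The image of an ultrafilter is an ultrafilter; it contains the compact interval [-c, c] and
    therefore converges. *)
Lemma ultra_bounded_cvg (u : nat -> R) c : (forall n, `|u n| <= c) ->
  cvg (u n @[n --> U]).
Proof.
move=> uc.
have uU : UltraFilter (u @ U).
  split=> [|G GP uG]; first exact: fmap_proper_filter.
  apply/seteqP; split=> // A GA.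
  have [//|UA] := in_ultra_setVsetC (u @^-1` A) UU.
  have GA' : G (~` A) by exact: uG.
  have : G (A `&` ~` A) by exact: filterI.
  by rewrite setICr => /filter_not_empty.
have := @segment_compact R (- c) c; rewrite compact_ultra => /(_ (u @ U) uU).
have h : (u @ U) `[- c, c]%classic.
  by apply: nearW => n /=; rewrite in_itv/= -ler_norml.
by move=> /(_ h)[l [_ ul]]; apply/cvg_ex; exists l.
Qed.

Definition ulim (u : nat -> R) := lim (u n @[n --> U]).

Lemma ulim_le (u v : nat -> R) c d : (forall n, `|u n| <= c) ->
  (forall n, `|v n| <= d) -> (forall n, u n <= v n) -> ulim u <= ulim v.
Proof.
move=> uc vd uv; apply: ler_lim; try exact: ultra_bounded_cvg.
exact: nearW.
Qed.

Lemma ulim_cst (u : nat -> R) r : (forall n, u n = r) -> ulim u = r.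
Proof.
move=> ur; apply/cvg_lim => //; rewrite (_ : u = fun=> r); last exact/funext.
exact: cvg_cst.
Qed.

Lemma ulim_linear (u v : nat -> R) r c d : (forall n, `|u n| <= c) ->
  (forall n, `|v n| <= d) -> ulim (fun n => u n + r * v n) = ulim u + r * ulim v.
Proof.
move=> uc vd; apply/cvg_lim => //; apply: cvgD; first exact: ultra_bounded_cvg uc.
apply: cvgMr; exact: ultra_bounded_cvg vd.
Qed.

(* The limit of the distribution functions along U need not be right-continuous;
   its right limits form the distribution function of the limit measure. *)
Definition wlim (x : nat -> set R -> R) (m : set R -> R) := forall t : R,
  ulim (fun n => x n `]-oo, y]%classic) @[y --> t^'+] --> m `]-oo, t]%classic.

Lemma wlim_unique x m m' c d : mball c m -> mball d m' ->
  wlim x m -> wlim x m' -> m = m'.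
Proof.
move=> mc md xm xm'; apply: (mball_unique mc md) => t.
exact: (cvg_unique _ (xm t) (xm' t)).
Qed.

Lemma wlim_linear x y m m' r c d :
  (forall n, mball c (x n)) -> (forall n, mball d (y n)) ->
  wlim x m -> wlim y m' -> wlim (fun n => x n + r *: y n) (m + r *: m').
Proof.
move=> xc yd xm ym t.
rewrite (_ : (fun z => _) = (fun z => ulim (fun n => x n `]-oo, z]%classic) +
   r * ulim (fun n => y n `]-oo, z]%classic))); last first.
  apply/funext => z; rewrite -(@ulim_linear _ _ r c d)// => n.
  - exact: mball_norm (xc n) _.
  - exact: mball_norm (yd n) _.
by apply: cvgD; [exact: xm|apply: cvgMr; exact: ym].
Qed.

Lemma on01_cdf0 (a : set R -> R) t : rcharge a -> on01 a -> t < 0 ->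
  a `]-oo, t]%classic = 0.
Proof.
move=> ra a01 t0; rewrite -a01// (_ : _ `&` _ = set0) ?(rcharge0 ra)//.
apply/seteqP; split=> x //=; rewrite !in_itv/= => -[xt /andP[x0 _]].
by have := le_lt_trans xt t0; rewrite ltNge x0.
Qed.

Lemma on01_cdf1 (a : set R -> R) t : on01 a -> 1 <= t ->
  a `]-oo, t]%classic = a setT.
Proof.
move=> a01 t1; rewrite -a01// -[RHS]a01//; congr (a _).
rewrite setTI; apply/seteqP; split=> x /=; rewrite !in_itv/=; first by case.
by move=> /andP[-> x1]; split=> //; exact: le_trans t1.
Qed.

(** The right limits [F] of the pointwise limit [G] satisfy the hypotheses of [stieltjes_rmeasure].
    No mass escapes: all measures sit on [0,1], so [G] is constant from 1 on, with value the limit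
    of the total masses. *)
Lemma wlim_rmeasure (a : nat -> set R -> R) c :
  (forall n, rmeasure (a n)) -> (forall n, on01 (a n)) ->
  (forall n, a n setT <= c) ->
  exists b, [/\ rmeasure b, on01 b, b setT = ulim (fun n => a n setT) & wlim a b].
Proof.
move=> ra a01 ac; pose G y := ulim (fun n => a n `]-oo, y]%classic).
have bd A n : `|a n A| <= c.
  by rewrite ger0_norm ?(ra n).2// (le_trans (rmeasure_leT A (ra n)))// ac.
have ndG x y : x <= y -> G x <= G y.
  move=> xy; apply: (@ulim_le _ _ c c) => // n; apply: rmeasure_le => // z /=.
  by rewrite !in_itv/= => /le_trans; exact.
have G0 t : t < 0 -> G t = 0.
  by move=> t0; apply: ulim_cst => n; rewrite on01_cdf0//; exact: (ra n).1.
have G1 t : 1 <= t -> G t = ulim (fun n => a n setT).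
  by move=> t1; rewrite /G; under eq_fun do rewrite on01_cdf1//.
have Gge0 t : 0 <= G t.
  rewrite -(@ulim_cst (fun=> 0) 0)//; apply: (@ulim_le _ _ 0 c) => //.
    by move=> n; rewrite normr0.
  by move=> n; exact: (ra n).2.
pose S t := G @` [set` Interval (BRight t) (BInfty R false)].
have lG t : has_lbound (S t) by exists 0 => _ [z _ <-].
pose F t := inf (S t).
have cG t : G y @[y --> t^'+] --> F t.
  exact: (@nondecreasing_at_right_cvgr R G t +oo%O isT (in2W ndG) (lG t)).
have FG t y : t < y -> F t <= G y.
  by move=> ty; apply: ge_inf => //; exists y => //=; rewrite in_itv/= ty.
have GF t r : (forall y, t < y -> r <= G y) -> r <= F t.
  move=> h; apply: lb_le_inf.
    by exists (G (t + 1)), (t + 1) => //=; rewrite in_itv/= andbT; lra.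
  by move=> _ [z /= + <-]; rewrite in_itv/= andbT; exact: h.
have ndF : {homo F : x y / x <= y}.
  by move=> x y xy; apply: GF => z yz; apply: FG; exact: le_lt_trans yz.
have rcF t : F y @[y --> t^'+] --> F t.
  have lF : has_lbound (F @` [set` Interval (BRight t) (BInfty R false)]).
    by exists 0 => _ [z _ <-]; apply: GF => y _.
  have := @nondecreasing_at_right_cvgr R F t +oo%O isT (in2W ndF) lF.
  set l := inf _ => Fl; suff -> : F t = l by [].
  apply/eqP; rewrite eq_le; apply/andP; split.
    apply: lb_le_inf; first by exists (F (t + 1)), (t + 1) => //=; rewrite in_itv/= andbT; lra.
    by move=> _ [z /= + <-]; rewrite in_itv/= andbT => tz; exact/ndF/ltW.
  (* The midpoint separates the two infima: l <= F((t + y) / 2) <= G(y) for every y > t. *)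
  apply: GF => y ty; apply: (@le_trans _ _ (F ((t + y) / 2))).
    by apply: ge_inf => //; exists ((t + y) / 2) => //=; rewrite in_itv/= andbT; lra.
  by apply: FG; lra.
have F0 t : t < 0 -> F t = 0.
  move=> t0; apply/eqP; rewrite eq_le; apply/andP; split; last exact: GF.
  by rewrite -(G0 (t / 2)) ?FG//; lra.
have F1' t : 1 <= t -> F t = ulim (fun n => a n setT).
  move=> t1; apply/eqP; rewrite eq_le; apply/andP; split.
    by rewrite -(G1 (t + 1)) ?FG//; lra.
  by apply: GF => y ty; rewrite G1//; lra.
have F1 t : 1 <= t -> F t = F 1 by move=> t1; rewrite !F1'.
have [b [rb b01 bF bT]] := stieltjes_rmeasure ndF rcF F0 F1.
exists b; split=> //; first by rewrite bT F1'.
by move=> t; rewrite bF; exact: cG.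
Qed.

(** Positive and negative parts converge separately. Their limits need not be mutually singular, but
    the sum of their masses is the limit of sums bounded by [c], so the radius is preserved. *)
Lemma wlim_ex (x : nat -> set R -> R) c : (forall n, mball c (x n)) ->
  exists2 m, mball c m & wlim x m.
Proof.
move=> xc; have /choice[a /choice[b ab]] := fun n => mball_jordan (xc n).
have ra n : rmeasure (a n) by case: (ab n) => -[].
have rb n : rmeasure (b n) by case: (ab n) => -[].
have a01 n : on01 (a n) by case: (ab n) => -[].
have b01 n : on01 (b n) by case: (ab n) => -[].
have xE n : x n = a n + (-1) *: b n by case: (ab n) => _ -> _; rewrite scaleN1r.
have abT n : a n setT + b n setT <= c by case: (ab n).
have aT n : a n setT <= c by have := abT n; have := (rb n).2 setT; lra.
have bT n : b n setT <= c by have := abT n; have := (ra n).2 setT; lra.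
have [al [ral al01 alT wa]] := wlim_rmeasure ra a01 aT.
have [be [rbe be01 beT wb]] := wlim_rmeasure rb b01 bT.
exists (al - be).
  apply: mball_of_jordan => //; rewrite alT beT -[X in _ + X]mul1r.
  have na n : `|a n setT| <= c by rewrite ger0_norm ?(ra n).2.
  have nb n : `|b n setT| <= c by rewrite ger0_norm ?(rb n).2.
  rewrite -(ulim_linear 1 na nb).
  apply: limr_le; last by apply: nearW => n /=; rewrite mul1r.
  apply: (@ultra_bounded_cvg _ c) => n; rewrite mul1r ger0_norm//.
  by apply: addr_ge0; [exact: (ra n).2|exact: (rb n).2].
rewrite -scaleN1r (_ : x = fun n => a n + (-1) *: b n); last exact/funext.
by apply: (@wlim_linear _ _ _ _ _ c c) => // n; exact: rmeasure_mball.
Qed.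

End ultralimit.

(** * Approximating a measure by absolutely continuous ones *)

Section spread.
Context {R : realType}.
Local Notation mR := (measurableTypeR R).
Local Notation mu := (@lebesgue_measure R).
Implicit Types (m a : set R -> R) (n i : nat).

Local Notation step n := (n.+1%:R^-1 : R).

(* Both families coincide for i > 0; the leftmost mass cell ]-h, 0] contains the
   atom at 0 and is spread over the cell to its right. *)
Definition mass_cell n i : set R := `](i%:R - 1) * step n, i%:R * step n]%classic.
Definition spread_cell n i : set R :=
  `]i.-1%:R * step n, i.-1.+1%:R * step n]%classic.

Definition unif n i : set R -> R :=
  n.+1%:R *: onm (fun A => fine (mu (A `&` spread_cell n i))).

(** The n + 2 cells are the leftmost one and the n + 1 cells tiling ]0, 1]; the mass found in each
    is redistributed uniformly. *)
Definition spread n m : set R -> R := \sum_(i < n.+2) m (mass_cell n i) *: unif n i.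

Lemma step_gt0 n : 0 < step n. Proof. by rewrite invr_gt0. Qed.

Lemma measurable_spread_cell n i : measurable (spread_cell n i).
Proof. exact: measurable_itv. Qed.

Lemma measurable_mass_cell n i : measurable (mass_cell n i).
Proof. exact: measurable_itv. Qed.

Hint Resolve measurable_spread_cell measurable_mass_cell : core.

Lemma mu_spread_cell n i : mu (spread_cell n i) = (step n)%:E.
Proof.
rewrite /spread_cell lebesgue_measure_itv/= lte_fin ltr_pM2r ?step_gt0//.
by rewrite ltr_nat ltnSn -EFinD -mulrBl -natrB// subSnn mul1r.
Qed.

Lemma unif_rmeasure n i : rmeasure (unif n i).
Proof.
pose nu : {measure set mR -> \bar R} := mrestr mu (measurable_spread_cell n i).
have nuE A : nu A = mu (A `&` spread_cell n i) by [].
have nufin A : measurable A -> nu A \is a fin_num.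
  move=> mA; rewrite ge0_fin_numE// nuE.
  apply: (@le_lt_trans _ _ (mu (spread_cell n i))).
    have mK := measurable_spread_cell n i.
    by apply: le_measure; rewrite ?inE//; exact: measurableI.
  by rewrite mu_spread_cell ltry.
split.
  apply: rchargeZ; apply: (@rcharge_fine _ nu) => //.
  exact: (@measure_semi_sigma_additive _ _ _ nu).
move=> A; apply: mulr_ge0 => //; rewrite /onm; case: ifPn => // _.
exact/fine_ge0.
Qed.

Lemma unifT n i : unif n i setT = 1.
Proof.
rewrite /unif !fctE onmE// setTI mu_spread_cell/=.
by rewrite -[_ *: _]/(_ * _) divff.
Qed.

Lemma unif_le1 n i A : unif n i A <= 1.
Proof. by rewrite -(unifT n i); apply: rmeasure_leT; exact: unif_rmeasure. Qed.

Lemma unif_on01 n i : (i < n.+2)%N -> on01 (unif n i).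
Proof.
move=> ni A mA; rewrite /unif !fctE !onmE//; last exact: measurableI.
congr (_ *: fine (mu _)); rewrite -setIA; congr (_ `&` _).
apply: setIidr => x; rewrite /spread_cell /= !in_itv/= => /andP[x0 x1].
apply/andP; split; first by apply: le_trans (ltW x0); rewrite mulr_ge0.
apply: (le_trans x1); rewrite ler_pdivrMr// mul1r ler_nat.
by case: i ni {x0 x1} => //=.
Qed.

Lemma unif_abscont n i : abscont (unif n i).
Proof.
move=> A mA A0; rewrite /unif !fctE onmE//; have mK := measurable_spread_cell n i.
have -> : mu (A `&` spread_cell n i) = 0%E.
  by apply: subset_measure0 A0 => //; exact: measurableI.
by rewrite /= scaler0.
Qed.

(** The first k mass cells tile ]-h, (k - 1)h] with h = 1/(n+1); for k = n + 2 this is ]-h, 1],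
    which contains [0,1]. *)
Lemma mass_cell_sum n a B : rcharge a -> on01 a -> measurable B ->
  \sum_(i < n.+2) a (mass_cell n i `&` B) = a B.
Proof.
move=> ra a01 mB; have h0 := step_gt0 n.
have part k : \sum_(i < k) a (mass_cell n i `&` B) =
    a (`](- step n), ((k%:R - 1) * step n)]%classic `&` B).
  elim: k => [|k IH].
    by rewrite big_ord0 sub0r mulN1r set_itv_ge ?set0I ?(rcharge0 ra)// bnd_simp ltxx.
  rewrite big_ord_recr/= IH -rchargeU//; try exact: measurableI.
    rewrite -setIUl; congr (a (_ `&` _)); rewrite /mass_cell -[k.+1%:R]natr1 addrK.
    apply/seteqP; split=> x /=; rewrite !in_itv/=.
      move=> [/andP[-> xk]|/andP[xk ->]] /=; first by rewrite (le_trans xk)// ler_pM2r// gerBl.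
      rewrite andbT; apply: le_lt_trans xk; rewrite mulrBl mul1r lerBrDl subrr.
      by rewrite mulr_ge0// ltW.
    move=> /andP[xh xk]; have [xk'|xk'] := leP x ((k%:R - 1) * step n).
      by left; rewrite xh.
    by right.
  rewrite setIACA (_ : _ `&` mass_cell _ _ = set0) ?set0I//.
  apply/seteqP; split=> x //=; rewrite !in_itv/= => -[/andP[_ xk] /andP[kx _]].
  by have := lt_le_trans kx xk; rewrite ltxx.
rewrite part -a01; last exact: measurableI.
rewrite -[RHS]a01//; congr (a _); rewrite -setIA; apply: setIidr => x [_ /=].
rewrite !in_itv/= => /andP[x0 x1]; apply/andP; split.
  by rewrite (lt_le_trans _ x0)// oppr_lt0.
by rewrite -[n.+2%:R]natr1 addrK divff.
Qed.

Lemma spreadE n m A : spread n m A = \sum_(i < n.+2) m (mass_cell n i) * unif n i A.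
Proof. by rewrite /spread fct_sumE. Qed.

Lemma spread_rmeasure n a : rmeasure a -> rmeasure (spread n a).
Proof.
move=> ra; split.
  rewrite /spread; elim/big_ind : _ => [|x y rx ry|i _].
  - exact: rcharge_zero.
  - by rewrite -[y]scale1r; exact: rcharge_linear.
  - by apply: rchargeZ; exact: (unif_rmeasure _ _).1.
move=> A; rewrite spreadE; apply: sumr_ge0 => i _.
by rewrite mulr_ge0 ?ra.2//; exact: (unif_rmeasure _ _).2.
Qed.

Lemma spread_on01 n m : on01 (spread n m).
Proof.
by move=> A mA; rewrite !spreadE; apply: eq_bigr => i _; rewrite unif_on01.
Qed.

Lemma spread_abscont n m : abscont (spread n m).
Proof.
by move=> A mA A0; rewrite spreadE big1// => i _; rewrite unif_abscont// mulr0.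
Qed.

Lemma spreadT n a : rmeasure a -> on01 a -> spread n a setT = a setT.
Proof.
move=> ra a01; rewrite spreadE -(mass_cell_sum n ra.1 a01 measurableT).
by apply: eq_bigr => i _; rewrite unifT mulr1 setIT.
Qed.

Lemma spread_linear n r m m' : spread n (m + r *: m') = spread n m + r *: spread n m'.
Proof.
apply/funext => A; rewrite !fctE !spreadE -[_ *: _]/(_ * _) mulr_sumr -big_split/=.
by apply: eq_bigr => i _; rewrite mulrDl -[r *: _]/(r * _) -[in LHS]mulrA.
Qed.

Lemma mball_spread n c m : mball c m -> acball c (spread n m).
Proof.
move=> /mball_jordan[a [b [[ra rb a01 b01] -> abc]]]; split; last exact: spread_abscont.
rewrite -scaleN1r spread_linear scaleN1r; apply: mball_of_jordan => //.
- exact: spread_rmeasure.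
- exact: spread_rmeasure.
- exact: spread_on01.
- exact: spread_on01.
- by rewrite !spreadT.
Qed.

(** Spreading moves mass by at most two steps. The extreme case is cell 0, where mass in ]-h, 0]
    goes to ]0, h]. *)
Lemma spread_cdf n a y : rmeasure a -> on01 a ->
  a `]-oo, y - 2 * step n]%classic <= spread n a `]-oo, y]%classic
    <= a `]-oo, y + 2 * step n]%classic.
Proof.
move=> ra a01; have h0 := step_gt0 n.
have near i s t : mass_cell n i t -> spread_cell n i s ->
    t <= s + 2 * step n /\ s <= t + 2 * step n.
  rewrite /mass_cell /spread_cell /= !in_itv/= => /andP[t1 t2] /andP[s1 s2].
  have [i1 i2] : i%:R - 1 <= i.-1%:R :> R /\ i.-1.+1%:R <= i%:R + 1 :> R.
    by case: i {t1 t2 s1 s2} => [|i]; rewrite -!natr1 /=; split; lra.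
  move: t1 t2 s1 s2 i1 i2; move: (i%:R : R) (i.-1%:R : R) (i.-1.+1%:R : R) (step n) h0.
  by move=> p q q' h h0 t1 t2 s1 s2 i1 i2; split; nra.
rewrite spreadE -(mass_cell_sum n ra.1 a01 (measurable_itv `]-oo, y - 2 * step n])).
rewrite -(mass_cell_sum n ra.1 a01 (measurable_itv `]-oo, y + 2 * step n])).
have mI i t : measurable (mass_cell n i `&` `]-oo, t]%classic) by exact: measurableI.
apply/andP; split; apply: ler_sum => i _.
(* Lower bound: if a mass cell meets ]-oo, y - 2h], its spread cell lies entirely to the left of
   y. *)
- have [->|/set0P[t [ti ty]]] :=
      eqVneq (mass_cell n i `&` `]-oo, y - 2 * step n]%classic) set0.
    by rewrite (rcharge0 ra.1) mulr_ge0 ?ra.2//; exact: (unif_rmeasure _ _).2.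
  suff -> : unif n i `]-oo, y]%classic = 1.
    by rewrite mulr1; apply: rmeasure_le => //; exact: subIsetl.
  rewrite -(unifT n i) /unif !fctE !onmE//; congr (_ *: fine (mu _)).
  rewrite setTI; apply: setIidr => s si; have [_] := near _ _ _ ti si.
  by move: ty; rewrite /= !in_itv/= => ty st; rewrite (le_trans st)// -lerBrDr.
(* Upper bound: if a spread cell meets ]-oo, y], its mass cell lies entirely in ]-oo, y + 2h]. *)
- have [E|/set0P[s [sy si]]] := eqVneq (`]-oo, y]%classic `&` spread_cell n i) set0.
    rewrite /unif !fctE onmE// E measure0/= scaler0 mulr0; exact: ra.2.
  rewrite (_ : _ `&` _ = mass_cell n i).
    by rewrite ler_piMr ?ra.2 ?unif_le1.
  apply: setIidl => t ti; have [+ _] := near _ _ _ ti si.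
  by move: sy; rewrite /= !in_itv/= => sy ts; rewrite (le_trans ts)// lerD2r.
Qed.

Context (U : set_system nat) {UU : UltraFilter U}.
Hypothesis ooU : \oo `<=` U.

(** Fix y > t. Once two steps are shorter than y - t, the distribution function of the spread at y
    lies between those of [a] at t and at t + 2(y - t). Such indices belong to [U], so the bounds
    pass to the limit, and right continuity of [a] closes the gap as y decreases to t. *)
Lemma wlim_spread_rmeasure a : rmeasure a -> on01 a -> wlim U (spread ^~ a) a.
Proof.
move=> ra a01 t.
have bd y n : `|spread n a `]-oo, y]%classic| <= a setT.
  have rs := spread_rmeasure n ra.
  by rewrite ger0_norm ?rs.2// -(spreadT n ra a01) rmeasure_leT.
have ev e : 0 < e -> \forall n \near U, 2 * step n < e.
  move=> e0; apply: ooU; have e2 : 0 < e / 2 by lra.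
  have : \forall n \near \oo, (harmonic n : R) < e / 2.
    exact: (cvgr_lt _ cvg_harmonic).
  by apply: filterS => n; rewrite /harmonic/= ltr_pdivlMr// mulrC.
have lb y : t < y -> a `]-oo, t]%classic <= ulim U (fun n => spread n a `]-oo, y]%classic).
  move=> ty; apply: limr_ge; first exact: ultra_bounded_cvg (bd y).
  have := ev (y - t); rewrite subr_gt0 => /(_ ty); apply: filterS => n nty.
  have /andP[+ _] := spread_cdf n y ra a01; apply: le_trans.
  apply: rmeasure_le => // z /=; rewrite !in_itv/= => /le_trans; apply.
  by rewrite lerBrDl -lerBrDr ltW.
have ub y : t < y -> ulim U (fun n => spread n a `]-oo, y]%classic) <=
    a `]-oo, t + 2 * (y - t)]%classic.
  move=> ty; apply: limr_le; first exact: ultra_bounded_cvg (bd y).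
  have := ev (y - t); rewrite subr_gt0 => /(_ ty); apply: filterS => n nty.
  have /andP[_] := spread_cdf n y ra a01; move=> /le_trans; apply.
  apply: rmeasure_le => // z /=; rewrite !in_itv/= => /le_trans; apply.
  by move: (2 * step n) nty => d; lra.
apply: (@squeeze_cvgr _ _ _ _ (fun=> a `]-oo, t]%classic)
  (fun y => a `]-oo, t + 2 * (y - t)]%classic)).
- by near=> y; apply/andP; split; [apply: lb|apply: ub].
- exact: cvg_cst.
- apply/cvg_at_rightP => u [ut cu].
  have /cvg_at_rightP := @rmeasure_right_continuous _ a t ra.
  move=> /(_ (fun n => t + 2 * (u n - t))); apply; split.
    by move=> n; have := ut n; lra.
  rewrite -[X in _ --> X]addr0 -(mulr0 2) -(subrr t).
  apply: cvgD; first exact: cvg_cst.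
  by apply: cvgMr; apply: cvgB => //; exact: cvg_cst.
Unshelve. all: by end_near. Qed.

Lemma wlim_spread c m : mball c m -> wlim U (spread ^~ m) m.
Proof.
move=> mc; have [a [b [[ra rb a01 b01] -> abc]]] := mball_jordan mc.
rewrite -scaleN1r (_ : spread^~ _ = fun n => spread n a + (-1) *: spread n b); last first.
  by apply/funext => n; rewrite spread_linear.
apply: (@wlim_linear _ _ _ _ _ _ _ _ (a setT) (b setT)) => [n|n||].
- apply: rmeasure_mball; [exact: spread_rmeasure|exact: spread_on01|].
  by rewrite spreadT.
- apply: rmeasure_mball; [exact: spread_rmeasure|exact: spread_on01|].
  by rewrite spreadT.
- exact: wlim_spread_rmeasure.
- exact: wlim_spread_rmeasure.
Qed.

End spread.

Lemma retract_M_linfAC (R : realType) : retract (@M01 R) (linf (@AC01 R)).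
Proof.
have [U [UU ooU]] := ultraFilterLemma (_ : ProperFilter \oo).
(* One limit measure for all radii at once, by uniqueness of weak limits; the value is 0 on
   unbounded sequences. *)
have /choice[q qP] : forall x : nat -> set R -> R, exists m,
    forall c, (forall n, mball c (x n)) -> wlim U x m /\ mball c m.
  move=> x; have [[c0 xc0]|nx] := pselect (exists c, forall n, mball c (x n)); last first.
    by exists 0 => c xc; exfalso; apply: nx; exists c.
  have [m mc0 xm] := wlim_ex xc0; exists m => c xc; split=> //.
  have [m' mc xm'] := wlim_ex xc; rewrite (_ : m = m')//.
  exact: wlim_unique mc0 mc xm xm'.
exists (fun (m : M01) n => spread n m : AC01), (q : linf AC01 -> M01); split.
- split=> [r x y _ _|]; first by apply/funext => n; exact: spread_linear.
  by exists 1 => // c m mc n; rewrite mul1r; exact: mball_spread.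
- split=> [r x y [c cx] [d dy]|].
    have {}cx n : mball c (x n) by exact: (cx n).1.
    have {}dy n : mball d (y n) by exact: (dy n).1.
    have cxy n : mball (c + `|r| * d) (x n + r *: y n) by exact/mballD/mballZ.
    have [wx bx] := qP _ _ cx; have [wy by'] := qP _ _ dy; have [wxy bxy] := qP _ _ cxy.
    apply: (wlim_unique bxy (mballD bx (mballZ r by')) wxy).
    exact: (wlim_linear cx dy).
  exists 1 => // c x cx; rewrite mul1r; apply: (qP _ _ _).2 => n; exact: (cx n).1.
- move=> m [c mc].
  have bs n : mball c (spread n m) by exact: (mball_spread n mc).1.
  have [wm bm] := qP _ _ bs.
  exact: (wlim_unique bm mc wm (wlim_spread ooU mc)).
Qed.

(** * Densities *)

Section density.
Context {R : realType}.
Local Notation mR := (measurableTypeR R).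
Local Notation mu := (@lebesgue_measure R).
Implicit Types (f g : R -> R) (A B D : set R).

Definition cint D f : set R -> R := onm (fun B => \int[mu]_(x in B `&` D) f x).

Lemma cintE D f B : measurable B -> cint D f B = \int[mu]_(x in B `&` D) f x.
Proof. exact: onmE. Qed.

Lemma cint_rcharge D f : measurable D -> mu.-integrable D (EFin \o f) ->
  rcharge (cint D f).
Proof.
move=> mD fD; have fT : mu.-integrable setT (EFin \o (f \_ D)).
  by rewrite -restrict_EFin; exact: (integrable_mkcond (mu := mu) _ mD).1.
pose nu : {charge set mR -> \bar R} := induced_charge fT.
have -> : cint D f = onm (fine \o nu).
  by apply/funext => A; rewrite /cint /onm /= Rintegral_mkcondr.
apply: rcharge_fine; first exact: (charge0 nu).
- by move=> A mA; exact: (@fin_num_measure _ _ _ nu).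
- exact: (@charge_semi_sigma_additive _ _ _ nu).
Qed.

Lemma cint_abscont D f : measurable D -> mu.-integrable D (EFin \o f) ->
  abscont (cint D f).
Proof.
move=> mD fD A mA A0; have mAD : measurable (A `&` D) by exact: measurableI.
rewrite cintE// /Rintegral null_set_integral//.
  by apply: measurable_funS (measurable_int _ fD) => //; exact: subIsetr.
by apply: subset_measure0 A0.
Qed.

Lemma integrable_normr D f : mu.-integrable D (EFin \o f) ->
  mu.-integrable D (EFin \o (fun x => `|f x|)).
Proof. by move=> /integrable_abse. Qed.

Lemma cint_norm_rmeasure D f : measurable D -> mu.-integrable D (EFin \o f) ->
  rmeasure (cint D (fun x => `|f x|)).
Proof.
move=> mD fD; split; first by apply: cint_rcharge => //; exact: integrable_normr.
by move=> A; rewrite /cint /onm; case: ifPn => // _; exact: Rintegral_ge0.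
Qed.

Lemma cint_le_norm D f B : measurable D -> mu.-integrable D (EFin \o f) ->
  `|cint D f B| <= cint D (fun x => `|f x|) B.
Proof.
move=> mD fD; rewrite /cint /onm; case: ifPn => [/asboolP mB|]; last by rewrite normr0.
apply: le_normr_Rintegral; first exact: measurableI.
by apply: integrableS fD => //; exact: measurableI.
Qed.

Lemma cint_linear D f g r : measurable D -> mu.-integrable D (EFin \o f) ->
  mu.-integrable D (EFin \o g) ->
  cint D (fun x => f x + r * g x) = cint D f + r *: cint D g.
Proof.
move=> mD fD gD; apply/funext => B; rewrite !fctE /cint /onm.
case: ifPn => [/asboolP mB|]; last by rewrite scaler0 addr0.
have mBD : measurable (B `&` D) by exact: measurableI.
have fB : mu.-integrable (B `&` D) (EFin \o f) by apply: integrableS fD.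
have gB : mu.-integrable (B `&` D) (EFin \o g) by apply: integrableS gD.
rewrite RintegralD//; first by rewrite RintegralZl.
rewrite (_ : EFin \o _ = fun x => (r%:E * (EFin \o g) x)%E)//.
exact: integrableZl.
Qed.

Lemma cint_var D f c : measurable D -> mu.-integrable D (EFin \o f) ->
  \int[mu]_(x in D) `|f x| <= c -> forall P N, measurable P -> measurable N ->
  P `&` N = set0 -> cint D f P - cint D f N <= c.
Proof.
move=> mD fD fc P N mP mN PN; have rv := cint_norm_rmeasure mD fD.
have := rchargeU rv.1 mP mN PN; have := rmeasure_leT (P `|` N) rv.
rewrite (cintE _ _ measurableT) setTI.
have := cint_le_norm P mD fD; have := cint_le_norm N mD fD.
by rewrite !ler_norml => /andP[? ?] /andP[? ?]; lra.
Qed.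

(** The sets where f >= 0 and where f < 0 attain the bound of [cint_var], so the L_1 norm can be
    recovered from the variation. *)
Lemma cint_norm_hahn D f : measurable D -> mu.-integrable D (EFin \o f) ->
  exists P N, [/\ measurable P, measurable N, P `&` N = set0 &
    \int[mu]_(x in D) `|f x| = cint D f P - cint D f N].
Proof.
move=> mD fD; have mf : measurable_fun D f.
  by apply/measurable_EFinP; exact: measurable_int fD.
pose P : set R := D `&` f @^-1` `[0, +oo[%classic.
have mP : measurable P by apply: mf => //; exact: measurable_itv.
have fS B : measurable B -> B `<=` D -> mu.-integrable B (EFin \o f).
  by move=> mB BD; apply: integrableS fD.
exists P, (D `\` P); split=> //; first exact: measurableD.
  by rewrite setDE setICA setICr setI0.
rewrite !cintE//; last exact: measurableD.
have -> : P `&` D = P by apply: setIidl; exact: subIsetl.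
have -> : (D `\` P) `&` D = D `\` P by apply: setIidl; exact: subDsetl.
have mDP : measurable (D `\` P) by exact: measurableD.
have DE : D = P `|` (D `\` P) by rewrite setDUK//; exact: subIsetl.
rewrite {1}DE Rintegral_setU//; last 2 first.
- by rewrite -DE; exact: integrable_normr.
- by apply/disj_setPS; rewrite setDE setICA setICr setI0.
congr (_ + _).
  apply: eq_Rintegral => x /set_mem[_]; rewrite /= in_itv/= andbT => x0.
  by rewrite ger0_norm.
rewrite -mulN1r -RintegralZl//; last by apply: fS => //; exact: subDsetl.
apply: eq_Rintegral => x /set_mem[Dx nP]; rewrite mulN1r ler0_norm//.
rewrite leNgt; apply/negP => x0; apply: nP; split=> //=.
by rewrite in_itv/= andbT ltW.
Qed.

Lemma radon_nikodym_density m : rcharge m -> abscont m -> exists g : R -> R,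
  mu.-integrable setT (EFin \o g) /\
  forall B, measurable B -> m B = \int[mu]_(x in B) g x.
Proof.
move=> cm am; have [nu nuE] := rcharge_charge cm.
have dom : nu `<< mu.
  by apply/null_content_dominatesP => A mA A0; rewrite nuE am.
have gE : EFin \o (fine \o Radon_Nikodym nu mu) = Radon_Nikodym nu mu.
  by apply/funext => x /=; rewrite fineK//; exact: Radon_Nikodym_fin_num.
exists (fine \o Radon_Nikodym nu mu); split.
  by rewrite gE; exact: Radon_Nikodym_integrable.
move=> B mB; apply: EFin_inj; rewrite -nuE /Rintegral.
rewrite (_ : \int[mu]_(x in B) _ = \int[mu]_(x in B) (Radon_Nikodym nu mu) x)%E.
  by rewrite -Radon_Nikodym_integral// nuE.
by apply: eq_integral => x _; rewrite -[RHS]/((Radon_Nikodym nu mu) x) -gE.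
Qed.

Definition affine (p q t : R) := p * t + q.

Lemma measurable_affine p q : measurable_fun setT (affine p q).
Proof.
apply: continuous_measurable_fun => t; apply: cvgD; last exact: cvg_cst.
by apply: cvgMr; exact: cvg_id.
Qed.

(** The rescaled pushforward of Lebesgue measure gives every interval ]a, b] its length, which
    characterises Lebesgue measure. *)
Lemma lebesgue_measure_affine (p q : R) A : 0 < p -> measurable A ->
  (p%:E * mu (affine p q @^-1` A) = mu A)%E.
Proof.
move=> p0 mA; have mf := measurable_affine p q : measurable_fun setT (affine p q : mR -> mR).
pose nu0 : {measure set mR -> \bar R} := pushforward mu (affine p q : mR -> mR).
pose nu : {measure set mR -> \bar R} := mscale (NngNum (ltW p0)) (nu0 mf).
apply/esym; apply: (@lebesgue_measure_unique _ nu) => // _ [[a b] _ <-] /=.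
rewrite /mscale/= /nu0 /= /pushforward.
rewrite (_ : _ @^-1` _ = `](a - q) / p, (b - q) / p]%classic); last first.
  apply/seteqP; split=> x /=; rewrite /affine !in_itv/=.
    by rewrite ltr_pdivrMr// ler_pdivlMr// [x * p]mulrC ltrBlDr lerBrDr.
  by rewrite ltr_pdivrMr// ler_pdivlMr// [x * p]mulrC ltrBlDr lerBrDr.
rewrite !lebesgue_measure_itv/= !lte_fin ltr_pM2r ?invr_gt0// ltrD2r.
case: ifPn => _; last by rewrite mule0.
by rewrite -!EFinD -EFinM; congr EFin; field; rewrite gt_eqF.
Qed.

Lemma null_affine (p q : R) A : 0 < p -> measurable A -> mu A = 0%E ->
  mu (affine p q @^-1` A) = 0%E.
Proof.
move=> p0 mA A0; have /eqP := lebesgue_measure_affine q p0 mA.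
by rewrite A0 mule_eq0 eqe gt_eqF//= => /eqP.
Qed.

End density.

(** * Moving a dyadic cell onto the unit interval *)

Section transfer.
Context {R : realType}.
Local Notation mu := (@lebesgue_measure R).
Implicit Types (f g : R -> R) (A B : set R) (s : R).

Definition cell s : set R := `]s / 2, s]%classic.

(* [affine (2 / s) (-1)] maps the cell ]s/2, s] onto ]0, 1]. *)
Definition transfer s f : set R -> R :=
  s^-1 *: onm (fun A => cint (cell s) f (affine (2 / s) (-1) @^-1` A)).

Lemma measurable_cell s : measurable (cell s).
Proof. exact: measurable_itv. Qed.

Lemma measurable_affine_preimage p q A : measurable A ->
  measurable (affine p q @^-1` A).
Proof.
by move=> mA; rewrite -[X in measurable X]setTI; exact: measurable_affine.
Qed.

Hint Resolve measurable_cell measurable_affine_preimage : core.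

Lemma affineK s : 0 < s -> cancel (affine (2 / s) (-1)) (affine (s / 2) (s / 2)).
Proof. by move=> s0 t; rewrite /affine; field; rewrite gt_eqF. Qed.

Lemma affineVK s : 0 < s -> cancel (affine (s / 2) (s / 2)) (affine (2 / s) (-1)).
Proof. by move=> s0 t; rewrite /affine; field; rewrite gt_eqF. Qed.

Lemma affine_cell s t : 0 < s -> cell s t <-> 0 < affine (2 / s) (-1) t <= 1.
Proof.
move=> s0; rewrite /cell /= in_itv/= /affine.
rewrite -(ltr_pM2l (_ : 0 < 2 / s)) ?divr_gt0// -(ler_pM2l (_ : 0 < 2 / s)) ?divr_gt0//.
have -> : 2 / s * (s / 2) = 1 by field; rewrite gt_eqF.
have -> : 2 / s * s = 2 by field; rewrite gt_eqF.
by rewrite subr_gt0 lerBlDr.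
Qed.

(** The factor 1/s in [transfer] turns the integral over the cell into the average-like quantity
    that the Cesaro norm controls. *)
Lemma transfer_acball s f c : 0 < s -> mu.-integrable (cell s) (EFin \o f) ->
  \int[mu]_(x in cell s) `|f x| <= s * c -> acball c (transfer s f).
Proof.
move=> s0 fs fc; have rc := cint_rcharge (measurable_cell s) fs.
have mpsi := measurable_affine (2 / s) (-1).
split; first split.
- by apply: rchargeZ; exact: rcharge_comp.
- move=> A mA; rewrite /transfer !fctE !onmE//; last exact: measurableI.
  rewrite !cintE; [|by auto|by apply: measurable_affine_preimage; exact: measurableI].
  congr (_ *: Rintegral _ _ _).
  apply/seteqP; split=> t /= [At /[dup] ct /(affine_cell _ s0)/andP[t0 t1]].
    by case: At.
  by split=> //; split=> //; rewrite in_itv/= t1 ltW.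
- move=> P N mP mN PN; rewrite /transfer !fctE !onmE// -scalerBr -[_ *: _]/(_ * _).
  rewrite mulrC ler_pdivrMr// [c * s]mulrC.
  apply: cint_var => //; try exact: measurable_affine_preimage.
  by rewrite -preimage_setI PN preimage_set0.
- move=> A mA A0; rewrite /transfer !fctE onmE//.
  rewrite (cint_abscont _ fs) ?scaler0//; first exact: measurable_affine_preimage.
  by apply: null_affine => //; rewrite divr_gt0.
Qed.

Lemma transfer_linear s f g r : mu.-integrable (cell s) (EFin \o f) ->
  mu.-integrable (cell s) (EFin \o g) ->
  transfer s (fun x => f x + r * g x) = transfer s f + r *: transfer s g.
Proof.
move=> fs gs; apply/funext => A; rewrite /transfer cint_linear// !fctE /onm.
by case: ifPn => _; rewrite ?scaler0 ?addr0// scalerDr !scalerA [r * _]mulrC.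
Qed.

Lemma eq_transfer s f g : {in cell s, f =1 g} -> transfer s f = transfer s g.
Proof.
move=> fg; apply/funext => A; rewrite /transfer !fctE /onm /cint /onm.
congr (_ *: _); case: ifPn => // _; case: ifPn => // _.
by apply: eq_Rintegral => x /set_mem[_ xs]; rewrite fg// inE.
Qed.

(** A Hahn pair of [f] on the cell is carried to [0,1] by the inverse affine map and tested against
    the variation bound there. *)
Lemma transfer_norm s f d : 0 < s -> mu.-integrable (cell s) (EFin \o f) ->
  mball d (transfer s f) -> \int[mu]_(x in cell s) `|f x| <= s * d.
Proof.
move=> s0 fs [_ _ fd].
have [P [N [mP mN PN ->]]] := cint_norm_hahn (measurable_cell s) fs.
pose A B := affine (s / 2) (s / 2) @^-1` B.
have mA B : measurable B -> measurable (A B) by exact: measurable_affine_preimage.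
have AE B : measurable B -> transfer s f (A B) = s^-1 * cint (cell s) f B.
  move=> mB; rewrite /transfer !fctE onmE; last exact: mA.
  congr (_ * cint _ _ _); apply/seteqP; split=> t /=; rewrite /A /= affineK//.
have := fd _ _ (mA _ mP) (mA _ mN); rewrite !AE// -mulrBr => h.
rewrite -ler_pdivrMl//; apply: h.
by rewrite /A -preimage_setI PN preimage_set0.
Qed.

(** Carry [m] back to the cell, rescale by s, and take the Radon-Nikodym density. *)
Lemma transfer_surj s m c : 0 < s -> acball c m -> exists g,
  mu.-integrable setT (EFin \o g) /\ transfer s g = m.
Proof.
move=> s0 [[cm m01 mc] am]; have mphi := measurable_affine (s / 2) (s / 2).
pose n := s *: onm (fun B => m (affine (s / 2) (s / 2) @^-1` B)).
have cn : rcharge n by apply: rchargeZ; exact: rcharge_comp.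
have an : abscont n.
  move=> A mA A0; rewrite /n !fctE onmE// am ?scaler0//.
    exact: measurable_affine_preimage.
  by apply: null_affine => //; rewrite divr_gt0.
have [g [gi gE]] := radon_nikodym_density cn an; exists g; split=> //.
have gs : mu.-integrable (cell s) (EFin \o g).
  by apply: integrableS gi => //; exact: measurable_cell.
apply: rcharge_ext => //.
  apply: rchargeZ; apply: rcharge_comp; last exact: measurable_affine.
  exact: cint_rcharge.
move=> A mA; have mpA := measurable_affine_preimage (2 / s) (-1) mA.
rewrite /transfer !fctE onmE// cintE//.
have mBC : measurable (affine (2 / s) (-1) @^-1` A `&` cell s) by exact: measurableI.
rewrite -gE// /n !fctE onmE// scalerA mulVf ?gt_eqF// scale1r.
have -> : affine (s / 2) (s / 2) @^-1` (affine (2 / s) (-1) @^-1` A `&` cell s) =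
    A `&` `]0, 1]%classic.
  apply/seteqP; split=> t /=.
    by move=> [At /(affine_cell _ s0)]; move: At; rewrite affineVK// in_itv.
  rewrite in_itv/= => -[At t01]; rewrite affineVK//; split=> //.
  by apply/(affine_cell _ s0); rewrite affineVK.
(* The cell only covers ]0, 1]; the missing point 0 has Lebesgue measure zero, so [m] does not
   charge it. *)
have E01 : `[0, 1]%classic = [set 0] `|` `]0, 1]%classic :> set R.
  by rewrite (setU1itv false)// bnd_simp.
rewrite -[RHS]m01// E01 setIUr rchargeU//.
- rewrite (am (A `&` [set 0])) ?add0r//; first exact: measurableI.
  by apply: subset_measure0 (lebesgue_measure_set1 0) => //; exact: measurableI.
- exact: measurableI.
- exact: measurableI.
- apply/seteqP; split=> x //= [[_ ->] [_]]; rewrite in_itv/= ltxx//.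
Qed.

End transfer.

(** * Cesaro spaces as sums of dyadic pieces *)

Section cesaro.
Context {R : realType}.
Local Notation mR := (measurableTypeR R).
Local Notation mu := (@lebesgue_measure R).
Implicit Types (f g : R -> R) (z : int) (x : R).

Lemma pow2_gt0 z : 0 < (2 : R) ^ z. Proof. exact: exprz_gt0. Qed.

Lemma pow2B1 z : (2 : R) ^ (z - 1) = 2 ^ z / 2.
Proof. by rewrite expfzDr// exprN1. Qed.

Lemma pow2_cell_inj z z' x : cell (2 ^ z) x -> cell (2 ^ z') x -> z = z'.
Proof.
rewrite /cell /= !in_itv/= -!pow2B1 => /andP[z1 z2] /andP[z1' z2'].
have le u v : (2 : R) ^ (u - 1) < x -> x <= 2 ^ v -> u <= v.
  move=> ux xv; have := lt_le_trans ux xv.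
  by rewrite ltr_eXz2l ?ltr1n// ltrBlDr ltzD1.
by apply/eqP; rewrite eq_le !le.
Qed.

(** Take the least n with 2^z / 2^(n+1) < y: minimality gives y <= 2^(z-n), which for n = 0 is the
    hypothesis. *)
Lemma pow2_cell_below z (y : R) : 0 < y -> y <= 2 ^ z ->
  exists n : nat, cell (2 ^ (z - n%:Z)) y.
Proof.
move=> y0 yz; have sE (j : nat) : (2 : R) ^ (z - j%:Z) = 2 ^ z / 2 ^+ j.
  by rewrite expfzDr// -exprnN.
have Py : exists n, 2 ^ z / 2 ^+ n.+1 < y.
  have [n ny] : exists n, (2 : R) ^ z / y < 2 ^+ n.
    exists (Num.bound ((2 : R) ^ z / y)).
    apply: (lt_trans (archi_boundP _)); first by rewrite divr_ge0// ltW// pow2_gt0.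
    by rewrite -natrX ltr_nat ltn_expl.
  exists n; rewrite ltr_pdivrMr ?exprn_gt0// -ltr_pdivrMl// mulrC.
  by apply: (lt_trans ny); rewrite ltr_eXn2l ?ltr1n.
have [n ny nmin] := ex_minnP Py; exists n => //; rewrite /cell /= in_itv/= sE.
rewrite -mulrA -invfM -exprSr ny /=.
case: n nmin {ny} => [|n] nmin; first by rewrite expr0 divr1.
by rewrite leNgt; apply/negP => /nmin; rewrite ltnn.
Qed.

Lemma pow2_cell_ex (y : R) : 0 < y -> exists z, cell (2 ^ z) y.
Proof.
move=> y0; have [|n yn] := @pow2_cell_below (Num.bound y)%:Z y y0.
  apply/ltW/(lt_le_trans (archi_boundP (ltW y0))).
  by rewrite -exprnP -natrX ler_nat ltnW// ltn_expl.
by exists ((Num.bound y)%:Z - n%:Z).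
Qed.

(** Both intervals are treated at once through the exponents [e k] of their dyadic cells. By
    [e_pred] the exponents continue downwards without gaps, as they must since an average over
    [0, x] sees every smaller cell. *)
Variables (I : set R) (e : nat -> int).
Hypothesis e_inj : injective e.
Hypothesis e_pred : forall k, exists l, e l = e k - 1.
Hypothesis I_pow : forall k, I (2 ^ e k).
Hypothesis I_itv : forall x, I x -> `[0, x]%classic `<=` I.
Hypothesis I_cover : I = [set 0] `|` \bigcup_k cell (2 ^ e k).

Local Notation C k := (cell ((2 : R) ^ e k)).

Lemma measurable_I : measurable I.
Proof.
rewrite I_cover; apply: measurableU => //.
by apply: bigcup_measurable => k _; exact: measurable_cell.
Qed.

Lemma cell_sub_I k : C k `<=` I.
Proof. by move=> x kx; rewrite I_cover; right; exists k. Qed.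

Lemma measurable_abs D f : measurable D -> D `<=` I -> measurable_fun I f ->
  measurable_fun (D : set mR) (fun t => (`|f t|)%:E).
Proof.
move=> mD DI mf; apply/measurable_EFinP; apply: measurableT_comp => //.
by apply: measurable_funS mf => //; exact: measurable_I.
Qed.

Lemma ces_norm_cell f c k : measurable_fun I f -> (ces_norm I f <= c%:E)%E ->
  (\int[mu]_(t in C k) (`|f t|)%:E <= (2 ^ e k * c)%:E)%E.
Proof.
move=> mf fc; have s0 := pow2_gt0 (e k); have Is := I_itv (I_pow k).
apply: (@le_trans _ _ (\int[mu]_(t in `[0%R, (2 : R) ^ e k]) (`|f t|)%:E)%E).
  apply: ge0_subset_integral => //; try exact: measurable_cell.
  - by apply: measurable_abs => //; exact: measurable_itv.
  - move=> x; rewrite /cell /= !in_itv/= => /andP[x0 ->]; rewrite andbT.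
    by apply: le_trans (ltW x0); rewrite divr_ge0// ltW.
rewrite EFinM -lee_pdivrMl//; apply: le_trans fc; apply: ereal_sup_ubound.
exists ((2 : R) ^ e k) => //; split; first exact: I_pow.
by rewrite /= in_itv/= s0.
Qed.

Lemma ces_integrable f c k : measurable_fun I f -> (ces_norm I f <= c%:E)%E ->
  mu.-integrable (C k) (EFin \o f).
Proof.
move=> mf fc; apply/integrableP; split.
  apply/measurable_EFinP; apply: measurable_funS mf; first exact: measurable_I.
  exact: cell_sub_I.
by apply: le_lt_trans (ces_norm_cell k mf fc) _; rewrite ltry.
Qed.

Lemma ces_norm_cellR f c k : measurable_fun I f -> (ces_norm I f <= c%:E)%E ->
  \int[mu]_(t in C k) `|f t| <= 2 ^ e k * c.
Proof.
move=> mf fc; rewrite -lee_fin /Rintegral fineK; first exact: ces_norm_cell.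
rewrite ge0_fin_numE; last exact: integral_ge0.
by apply: le_lt_trans (ces_norm_cell k mf fc) _; rewrite ltry.
Qed.

(** Origin of the 4: let x lie in the cell with right end s. The cells ending at s, s/2, s/4, ...
    cover ]0, x], their integrals add up to at most sd(1 + 1/2 + 1/4 + ...) = 2sd, and s < 2x. *)
Lemma cell_norm_ces f d : measurable_fun I f -> 0 <= d ->
  (forall k, mu.-integrable (C k) (EFin \o f)) ->
  (forall k, \int[mu]_(t in C k) `|f t| <= 2 ^ e k * d) ->
  (ces_norm I f <= (4 * d)%:E)%E.
Proof.
move=> mf d0 fi fd; apply: ge_ereal_sup => _ [x [Ix x0] <-].
have {}x0 : 0 < x by move: x0; rewrite /= in_itv/= andbT.
have [k xk] : exists k, C k x.
  by move: Ix; rewrite I_cover => -[/= x00|[k _ xk]]; [rewrite x00 ltxx in x0|exists k].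
have /choice[l lE] : forall j, exists l, e l = e k - j%:Z.
  elim=> [|j [l lE]]; first by exists k; rewrite subr0.
  by have [l' l'E] := e_pred l; exists l'; rewrite l'E lE -addn1 PoszD opprD addrA.
have sE j : (2 : R) ^ e (l j) = 2 ^ e k / 2 ^+ j.
  by rewrite lE expfzDr// -exprnN.
have mC j : measurable (C (l j)) by exact: measurable_cell.
have xI : `]0, x]%classic `<=` I.
  by apply: subset_trans (I_itv Ix); apply: subset_itvr; rewrite bnd_simp.
rewrite lee_pdivrMl// -integral_itv_obnd_cbnd; last first.
  exact: (measurable_abs (measurable_itv `]0, x]) xI mf).
have xU : `]0, x]%classic `<=` \bigcup_j C (l j).
  move=> y; rewrite /= in_itv/= => /andP[y0 yx].
  have [n yn] : exists n : nat, cell (2 ^ (e k - n%:Z)) y.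
    apply: pow2_cell_below => //; apply: (le_trans yx).
    by move: xk; rewrite /cell /= in_itv/= => /andP[].
  by exists n => //; rewrite lE.
have UI : \bigcup_j C (l j) `<=` I by move=> y [j _]; exact: cell_sub_I.
have mU : measurable (\bigcup_j C (l j)) by exact: bigcup_measurable.
apply: (@le_trans _ _ (\int[mu]_(t in \bigcup_j C (l j)) (`|f t|)%:E)%E).
  by apply: ge0_subset_integral => //; exact: measurable_abs.
rewrite ge0_integral_bigcup//; last 2 first.
- exact: measurable_abs.
- move=> i j _ _ [y [yi yj]]; have := pow2_cell_inj yi yj.
  by rewrite !lE => /addrI/oppr_inj/eqP; rewrite eqz_nat => /eqP.
apply: (@le_trans _ _ (2 * (2 ^ e k * d))%:E); last first.
  rewrite lee_fin; move: xk; rewrite /cell /= in_itv/= => /andP[kx _]; nra.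
have sd0 : 0 <= 2 * (2 ^ e k * d) by rewrite !mulr_ge0// ltW// pow2_gt0.
(* The j-th bound sd/2^j is written as 2sd/2^(j+1), the general term of a series with sum 2sd. *)
apply: le_trans (epsilon_trick0 xpredT sd0).
apply: lee_nneseries => [j _ _|j _]; first exact: integral_ge0.
have -> : (\int[mu]_(t in C (l j)) (`|f t|)%:E)%E = (\int[mu]_(t in C (l j)) `|f t|)%:E.
  rewrite /Rintegral fineK//; apply: integrable_fin_num; first exact: mC.
  exact: (integrable_normr (fi (l j))).
rewrite lee_fin; apply: le_trans (fd (l j)) _; rewrite sE natrX exprS.
by rewrite le_eqVlt; apply/orP; left; apply/eqP; field; rewrite expf_neq0.
Qed.

(** Cells of different index are disjoint, so pointwise choice is consistent; the point 0, in no
    cell, enters measurability as a singleton. *)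
Lemma glue_cells (g : nat -> R -> R) : (forall k, measurable_fun (C k) (g k)) ->
  exists f, measurable_fun I f /\ forall k, {in C k, f =1 g k}.
Proof.
move=> mg; have /choice[f fE] : forall t, exists v, forall k, C k t -> v = g k t.
  move=> t; have [[k kt]|nt] := pselect (exists k, C k t); last first.
    by exists 0 => k kt; exfalso; apply: nt; exists k.
  by exists (g k t) => l lt'; rewrite (e_inj (pow2_cell_inj kt lt')).
have fC k : {in C k, f =1 g k} by move=> t /set_mem; exact: fE.
exists f; split=> //; rewrite I_cover.
apply/measurable_funU => //.
  by apply: bigcup_measurable => k _; exact: measurable_cell.
split; first exact: measurable_fun_set1.
apply/measurable_fun_bigcup => k; first exact: measurable_cell.
by apply: eq_measurable_fun (mg k) => t tk; rewrite (fC k).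
Qed.

Definition ces_seq f : linf (@AC01 R) := fun k => transfer (2 ^ e k) f.

Lemma ces_seq_ball f c : measurable_fun I f -> (ces_norm I f <= c%:E)%E ->
  nball c (ces_seq f).
Proof.
move=> mf fc k; apply: transfer_acball (pow2_gt0 _) _ _.
  exact: ces_integrable mf fc.
exact: ces_norm_cellR.
Qed.

Lemma ball_ces_norm f d : measurable_fun I f ->
  (forall k, mu.-integrable (C k) (EFin \o f)) ->
  nball d (ces_seq f) -> (ces_norm I f <= (4 * d)%:E)%E.
Proof.
move=> mf fi fd; apply: cell_norm_ces => //; first exact: nball_ge0 fd.
by move=> k; apply: transfer_norm (pow2_gt0 _) (fi k) (fd k).1.
Qed.

(** Choose a density for each coordinate and glue them along the cells. *)
Lemma ces_seq_surj d (x : linf (@AC01 R)) : nball d x -> exists f,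
  [/\ measurable_fun I f, (ces_norm I f <= (4 * d)%:E)%E & ces_seq f = x].
Proof.
move=> xd.
have /choice[g gP] := fun k => transfer_surj (pow2_gt0 (e k)) (xd k).
have mg k : measurable_fun (C k) (g k).
  apply: (@measurable_funS _ _ mR _ setT) => //.
  by apply/measurable_EFinP; exact: measurable_int (gP k).1.
have [f [mf fg]] := glue_cells mg.
have fx : ces_seq f = x.
  by apply/funext => k; rewrite /ces_seq (eq_transfer (fg k)) (gP k).2.
exists f; split=> //; apply: ball_ces_norm => //; last by rewrite fx.
move=> k; apply: (@eq_integrable _ _ _ mu _ _ (EFin \o g k)) => //.
- exact: measurable_cell.
- by move=> t tk; rewrite /= (fg k).
- by apply: integrableS (gP k).1 => //; exact: measurable_cell.
Qed.

End cesaro.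

(** * Comparison with the charges and total variation of the statement *)

Section bridge.
Context {R : realType}.
Implicit Types (m : set R -> R) (nu : {charge set R -> \bar R}).

Lemma mball_tv01 c m (nu : set R -> \bar R) : mball c m ->
  (forall A, measurable A -> nu A = (m A)%:E) -> (tv01 nu <= c%:E)%E.
Proof.
move=> /mball_jordan[a [b [[ra rb _ _] -> abc]]] nuE.
apply: ge_ereal_sup => _ [n [F [mF [tF ->]]]].
have sumF p : rmeasure p -> \sum_(i < n) p (F i) <= p setT.
  move=> rp; have [q qE] := rmeasure_measure rp.
  rewrite -lee_fin -sumEFin; under eq_bigr do rewrite -qE.
  rewrite -measure_bigsetU//; last by move=> i; exact: (mF i).1.
  rewrite -qE; apply: le_measure; rewrite ?inE//.
  by apply: bigsetU_measurable => i _; exact: (mF i).1.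
apply: (@le_trans _ _ (\sum_(i < n) (a (F i) + b (F i)))%:E).
  rewrite -sumEFin; apply: lee_sum => i _; rewrite nuE; last exact: (mF i).1.
  rewrite /= lee_fin !fctE ler_norml; have := ra.2 (F i); have := rb.2 (F i) => ? ?.
  by apply/andP; split; lra.
rewrite lee_fin big_split/=; apply: le_trans abc.
by apply: lerD; exact: sumF.
Qed.

(** A charge of the statement lives on all of R, but only its values inside [0,1] matter; the rest
    is discarded to land in [M01]. *)
Definition restr01 nu := onm (fun A => fine (nu (A `&` `[0, 1]%classic))).

Lemma restr01_mball d nu : (tv01 nu <= d%:E)%E -> mball d (restr01 nu).
Proof.
move=> nud.
have mI (A : set R) : measurable A -> measurable (A `&` `[0, 1]%classic).
  by move=> mA; exact: measurableI.
have nufin (A : set R) : measurable A -> nu A \is a fin_num.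
  by move=> mA; exact: fin_num_measure.
split.
- have -> : restr01 nu =
      onm (fun A => onm (fine \o nu) (A `&` `[0, 1]%classic)).
    apply/funext => A; rewrite /restr01 /onm; case: ifPn => // /asboolP mA.
    by rewrite asboolT//; exact: mI.
  apply: rcharge_restr => //; apply: rcharge_fine => //; first exact: charge0.
  exact: (@charge_semi_sigma_additive _ _ _ nu).
- by move=> A mA; rewrite /restr01 !onmE//; [rewrite -setIA setIid|exact: mI].
- move=> P N mP mN PN; rewrite /restr01 !onmE// -lee_fin.
  (* The pair (P, N), cut to [0,1], is a two-term family admissible in [tv01]. *)
  pose F (i : nat) := if i is 0%N then P `&` `[0, 1]%classic
    else if i is 1%N then N `&` `[0, 1]%classic else set0 : set R.
  have F2 : (\sum_(i < 2) `|nu (F i)| <= d%:E)%E.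
    apply: le_trans nud; apply: ereal_sup_ubound; exists 2%N, F; split.
      move=> [|[|i]] /=; split.
      - exact: mI.
      - exact: subIsetr.
      - exact: mI.
      - exact: subIsetr.
      - exact: measurable0.
      - exact: sub0set.
    split=> //; apply/trivIsetP => -[|[|i]] [|[|j]] //= _ _ _; rewrite ?set0I ?setI0//.
      by rewrite setIACA PN set0I.
    by rewrite setIACA [N `&` _]setIC PN set0I.
  apply: le_trans F2; rewrite !big_ord_recl big_ord0/= adde0.
  rewrite EFinB !fineK ?nufin//; try exact: mI.
  by apply: leeD; [exact: lee_abs|rewrite -abseN; exact: lee_abs].
Qed.

End bridge.

Section cesaro_iso.
Context {R : realType}.
Variables (I : set R) (e : nat -> int).
Hypothesis e_inj : injective e.
Hypothesis e_pred : forall k, exists l, e l = e k - 1.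
Hypothesis I_pow : forall k, I (2 ^ e k).
Hypothesis I_itv : forall x, I x -> `[0, x]%classic `<=` I.
Hypothesis I_cover : I = [set 0] `|` \bigcup_k cell (2 ^ e k).

Let ces_fin (f : R -> R) : Ces_inf I f -> exists2 c, 0 <= c & ces_norm I f = c%:E.
Proof.
move=> [mf fy]; have f0 : (0 <= ces_norm I f)%E.
  (* The point 2^(e 0) shows that the supremum is over a nonempty set of nonnegative averages, so it
     cannot be -oo. *)
  have s0 : 0 < (2 : R) ^ e 0%N by exact: pow2_gt0.
  apply: (@le_trans _ _ (((2 : R) ^ e 0%N)^-1%:E *
      \int[lebesgue_measure]_(t in `[0%R, (2 : R) ^ e 0%N]) (`|f t|)%:E)%E).
    by apply: mule_ge0; [rewrite lee_fin invr_ge0 ltW|exact: integral_ge0].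
  apply: ereal_sup_ubound; exists ((2 : R) ^ e 0%N) => //; split=> //.
  by rewrite /= in_itv/= s0.
have ffin : ces_norm I f \is a fin_num by rewrite ge0_fin_numE.
by exists (fine (ces_norm I f)); [exact: fine_ge0|rewrite fineK].
Qed.

(** [T] is [U] after the cutting map [J]. [J] does not increase norms and is inverted at the cost of
    a factor 4, while [U] and its inverse [S] are bounded by [C1] and [C2]; hence C = C1 + 4 C2
    serves both inequalities. *)
Lemma cesaro_isomorphism :
  exists (T : (R -> R) -> nat -> {charge set R -> \bar R}) (C : R),
    0 < C /\
    (forall (f g : R -> R) (a : R), Ces_inf I f -> Ces_inf I g ->
       forall (k : nat) (A : set R), measurable A -> A `<=` `[0, 1] ->
         T (fun t => f t + a * g t) k A = (T f k A + a%:E * T g k A)%E) /\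
    (forall f : R -> R, Ces_inf I f ->
       (linf_tv01 (fun k => T f k) <= C%:E * ces_norm I f)%E /\
       (ces_norm I f <= C%:E * linf_tv01 (fun k => T f k))%E) /\
    (forall nu : nat -> {charge set R -> \bar R},
       (linf_tv01 (fun k => nu k) < +oo)%E ->
       exists f : R -> R, Ces_inf I f /\
         forall (k : nat) (A : set R), measurable A -> A `<=` `[0, 1] ->
           T f k A = nu k A).
Proof.
have [U [S [bU bS SU US]]] :=
  pelczynski_decomposition (@retract_AC_M R) (@retract_M_linfAC R).
have [[lU [C1 C10 C1U]] [_ [C2 C20 C2S]]] := (bU, bS).
pose J := @ces_seq R e.
have Jball f c : Ces_inf I f -> ces_norm I f = c%:E -> nball c (J f).
  by move=> [mf _] fc; apply: (ces_seq_ball I_pow I_itv I_cover) => //; rewrite fc.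
have fint f k : Ces_inf I f ->
    lebesgue_measure.-integrable (cell ((2 : R) ^ e k)) (EFin \o f).
  move=> cf; have [c _ fc] := ces_fin cf; case: cf => mf _.
  by apply: (ces_integrable I_pow I_itv I_cover k mf (c := c)); rewrite fc.
have Jlin f g a : Ces_inf I f -> Ces_inf I g ->
    J (fun t => f t + a * g t) = J f + a *: J g.
  move=> cf cg; apply/funext => k; rewrite /J /ces_seq /= transfer_linear//; exact: fint.
(* Functions outside [Ces_inf I] are sent to an arbitrary charge. *)
have /choice[T TE] : forall f, exists nu : nat -> {charge set R -> \bar R},
    Ces_inf I f -> forall k A, nu k A = (U (J f) k A)%:E.
  move=> f; have [cf|ncf] := pselect (Ces_inf I f); last first.
    have [nu _] := rcharge_charge_default (@rcharge_zero R).
    by exists (fun=> nu) => /ncf.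
  have [c _ fc] := ces_fin cf; have b := C1U _ _ (Jball _ _ cf fc).
  have /choice[nu nuE] : forall k, exists nu : {charge set R -> \bar R},
      forall A, nu A = (U (J f) k A)%:E.
    by move=> k; apply: rcharge_charge_default; case: (b k).
  by exists nu.
have tv0 (nu : set R -> \bar R) : (0 <= tv01 nu)%E.
  apply: ereal_sup_ubound; exists 0%N, (fun=> set0); split.
    by move=> i; split=> //; exact: sub0set.
  by split; [move=> i j _ _ [x []]|rewrite big_ord0].
have linf0 (nu : nat -> set R -> \bar R) : (0 <= linf_tv01 nu)%E.
  by apply: le_trans (tv0 (nu 0%N)) _; apply: ereal_sup_ubound; exists 0%N.
have up f c : Ces_inf I f -> 0 <= c -> ces_norm I f = c%:E ->
    (linf_tv01 (fun k => T f k) <= (C1 * c)%:E)%E.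
  move=> cf c0 fc; apply: ge_ereal_sup => _ [k _ <-].
  apply: (mball_tv01 (C1U _ _ (Jball _ _ cf fc) k)) => A _; exact: TE.
exists T, (C1 + 4 * C2); split; first by rewrite addr_gt0// mulr_gt0.
split; last split.
- move=> f g a cf cg k A mA A01.
  have [c c0 fc] := ces_fin cf; have [d d0 gd] := ces_fin cg.
  have bf := Jball _ _ cf fc; have bg := Jball _ _ cg gd.
  have cfg : Ces_inf I (fun t => f t + a * g t).
    have mfg : measurable_fun I (fun t => f t + a * g t).
      case: cf cg => mf _ [mg _]; apply: measurable_funD => //.
      exact: measurable_funM.
    (* That the combination stays in the space is read off on the dyadic side, where the balls are
       already known to add and scale. *)
    split=> //; apply: (@le_lt_trans _ _ (4 * (c + `|a| * d))%:E); last by rewrite ltry.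
    apply: (ball_ces_norm e_pred I_itv I_cover) => //.
      move=> l; rewrite (_ : EFin \o _ =
        (fun t => ((EFin \o f) t + a%:E * (EFin \o g) t)%E))//.
      apply: integrableD; [exact: measurable_cell|exact: fint|].
      by apply: integrableZl; [exact: measurable_cell|exact: fint].
    by rewrite -/(J _) Jlin//; exact: (nballD bf (nballZ a bg)).
  rewrite !TE// Jlin// lU; first by rewrite -EFinM -EFinD.
  - by exists c; exact: bf.
  - by exists d; exact: bg.
- move=> f cf; have [c c0 fc] := ces_fin cf; have h := up _ _ cf c0 fc.
  split.
    apply: le_trans h _; rewrite fc -EFinM lee_fin ler_wpM2r// lerDl mulr_ge0// ltW//.
  have lfin : linf_tv01 (fun k => T f k) \is a fin_num.
    by rewrite ge0_fin_numE// (le_lt_trans h)// ltry.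
  rewrite -(fineK lfin) -EFinM; set d := fine _.
  have d0 : 0 <= d by exact: fine_ge0.
  have bd : nball d (U (J f)).
    move=> k; have tk : (tv01 (T f k) <= d%:E)%E.
      by rewrite /d fineK//; apply: ereal_sup_ubound; exists k.
    have [rU U01 _] := C1U _ _ (Jball _ _ cf fc) k.
    (* [U (J f) k] is concentrated on [0,1], so restricting the charge [T f k] gives it back, and
       the bound on [tv01] becomes membership in a ball. *)
    have b := restr01_mball tk; rewrite (_ : U (J f) k = restr01 (T f k))//.
    apply: rcharge_ext => //; first by case: b.
    by move=> A mA; rewrite /restr01 onmE// TE//= U01.
  have := C2S _ _ bd; rewrite SU; last by exists c; exact: Jball.
  move=> /(ball_ces_norm e_pred I_itv I_cover cf.1 (fun k => fint f k cf)).
  by move=> /le_trans; apply; rewrite lee_fin mulrA ler_wpM2r// lerDr ltW.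
- move=> nu nuy; have lfin : linf_tv01 (fun k => nu k) \is a fin_num.
    by rewrite ge0_fin_numE.
  pose d := fine (linf_tv01 (fun k => nu k)).
  have yd : nball d ((fun k => restr01 (nu k)) : linf M01).
    move=> k; apply: restr01_mball; rewrite /d fineK//.
    by apply: ereal_sup_ubound; exists k.
  (* [S] sends the restricted charges to a bounded sequence of absolutely continuous measures, which
     is the image under [J] of some f. *)
  have [f [mf fy fx]] := ces_seq_surj e_inj e_pred I_itv I_cover (C2S _ _ yd).
  have cf : Ces_inf I f by split=> //; rewrite (le_lt_trans fy)// ltry.
  exists f; split=> // k A mA A01; rewrite TE// /J fx US; last by exists d.
  rewrite /restr01 onmE// (setIidl A01) fineK//; exact: fin_num_measure.
Qed.

End cesaro_iso.

(** The enumeration 0, 1, -1, 2, -2, ... of the integers. *)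
Definition int_enum (k : nat) : int :=
  if odd k then (k./2.+1)%:Z else - (k./2)%:Z.

Lemma int_enum_inj : injective int_enum.
Proof. move=> k l; rewrite /int_enum; case: ifP; case: ifP; lia. Qed.

Lemma int_enum_surj z : exists k, int_enum k = z.
Proof.
case: z => [[|n]|n]; first by exists 0%N.
  by exists (n.*2.+1); rewrite /int_enum /= odd_double /= uphalf_double.
by exists (n.+1.*2); rewrite /int_enum odd_double doubleK NegzE.
Qed.

Theorem theorem14 (R : realType) (I : set R) :
  I = `[0, 1]%classic \/ I = `[0, +oo[%classic ->
  exists (T : (R -> R) -> nat -> {charge set R -> \bar R}) (C : R),
    0 < C /\
    (* linearity *)
    (forall (f g : R -> R) (a : R), Ces_inf I f -> Ces_inf I g ->
       forall (k : nat) (A : set R), measurable A -> A `<=` `[0, 1] ->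
         T (fun t => f t + a * g t) k A = (T f k A + a%:E * T g k A)%E) /\
    (* two-sided norm bounds *)
    (forall f : R -> R, Ces_inf I f ->
       (linf_tv01 (fun k => T f k) <= C%:E * ces_norm I f)%E /\
       (ces_norm I f <= C%:E * linf_tv01 (fun k => T f k))%E) /\
    (* surjectivity onto the l_infty-sum of M[0,1] *)
    (forall nu : nat -> {charge set R -> \bar R},
       (linf_tv01 (fun k => nu k) < +oo)%E ->
       exists f : R -> R, Ces_inf I f /\
         forall (k : nat) (A : set R), measurable A -> A `<=` `[0, 1] ->
           T f k A = nu k A).
Proof.
move=> [->|->].
- have pow_le1 (k : nat) : (2 : R) ^ (- k%:Z) <= 1.
    by rewrite -exprnN invf_le1 ?exprn_gt0// exprn_ege1// ler1n.
  (* On [0,1] the cells end at 1, 1/2, 1/4, ...; the half-line below uses all integer exponents. *)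
  apply: (@cesaro_isomorphism _ _ (fun k => - k%:Z)).
  + by move=> k l /oppr_inj/eqP; rewrite eqz_nat => /eqP.
  + by move=> k; exists k.+1; rewrite -addn1 PoszD opprD.
  + by move=> k; rewrite /= in_itv/= pow_le1 andbT ltW// pow2_gt0.
  + move=> x; rewrite /= in_itv/= => /andP[_ x1] y /=; rewrite !in_itv/=.
    by move=> /andP[-> yx]; exact: le_trans x1.
  + apply/seteqP; split=> x /=; rewrite in_itv/=.
      move=> /andP[+ x1]; rewrite le_eqVlt => /predU1P[<-|x0]; [by left|right].
      have [|n xn] := @pow2_cell_below _ 0 x x0; first by rewrite expr0z.
      by exists n => //; move: xn; rewrite sub0r.
    move=> [->|[k _]]; first by rewrite lexx ler01.
    rewrite /cell /= in_itv/= => /andP[x0 x1]; rewrite (le_trans x1)// andbT.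
    by apply: le_trans (ltW x0); rewrite divr_ge0// ltW// pow2_gt0.
- apply: (@cesaro_isomorphism _ _ int_enum).
  + exact: int_enum_inj.
  + by move=> k; exact: int_enum_surj.
  + by move=> k; rewrite /= in_itv/= andbT ltW// pow2_gt0.
  + by move=> x _ y; rewrite /= !in_itv/= => /andP[->].
  + apply/seteqP; split=> x /=; rewrite in_itv/= andbT.
      rewrite le_eqVlt => /predU1P[<-|x0]; [by left|right].
      have [z xz] := pow2_cell_ex x0; have [k kz] := int_enum_surj z.
      by exists k => //; rewrite kz.
    move=> [->|[k _]]; first exact: lexx.
    rewrite /cell /= in_itv/= => /andP[x0 x1].
    by apply: le_trans (ltW x0); rewrite divr_ge0// ltW// pow2_gt0.
Qed.
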